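(* Let $\Gamma=(w,Q)$ be a connected $\mathbb{Z}^d$-periodic graph with finite fundamental cell. Then the top spectral band of $\mathcal{H}_\Gamma=\mathcal{A}_\Gamma+Q$ is not entirely flat (i.e. the largest Floquet eigenvalue function $E_\nu(\cdot)$ is not constant on $\mathbb{T}^d$), and the maximum of the spectrum of $\mathcal{H}_\Gamma$ is not an eigenvalue of $\mathcal{H}_\Gamma$.
   Context: A $\mathbb{Z}^d$-periodic graph with finite fundamental cell $\Gamma=(w,Q)$ consists of: a countable vertex set $V\subset\mathbb{R}^d$ and linearly independent $\mathfrak{a}_1,\dots,\mathfrak{a}_d\in\mathbb{R}^d$ such that, with $k_{\mathfrak a}=\sum_i k_i\mathfrak{a}_i$ for $k\in\mathbb{Z}^d$, every $v\in V$ is uniquely $v=v_0+k_{\mathfrak a}$ with $v_0\in V_0=\{v_1,\dots,v_\nu\}$ (finite), $k\in\mathbb{Z}^d$, and all such points are in $V$; a function $w:V\times V\to[0,\infty)$ with $w(v,v')=w(v',v)$, $w(v,v)=0$, $\sum_{v'}w(v,v')<\infty$, $w(v+k_{\mathfrak a},v'+k_{\mathfrak a})=w(v,v')$; a potential $Q:V\to\mathbb{R}$ with $Q(v+k_{\mathfrak a})=Q(v)$. Connected means that the graph with edges $\{w(v,v')>0\}$ is connected. Put $w_{ij}(k)=w(v_i,v_j+k_{\mathfrak a})$, $Q_i=Q(v_i)$. On $\ell^2(V)$, $(\mathcal{H}_\Gamma\psi)(v)=(\mathcal{A}_\Gamma\psi)(v)+Q(v)\psi(v)$ with $(\mathcal{A}_\Gamma\psi)(v)=\sum_{v'}w(v,v')\psi(v')$.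 Let $\mathbb{T}^d=\mathbb{R}^d/\mathbb{Z}^d$. The Floquet matrix is the Hermitian matrix $H(\theta)=(h_{ij}(\theta))_{i,j=1}^\nu$, $h_{ij}(\theta)=\sum_{k\in\mathbb{Z}^d}w_{ij}(k)e^{2\pi i\theta\cdot k}+\delta_{ij}Q_i$, with eigenvalues $E_1(\theta)\le\dots\le E_\nu(\theta)$; one has $\sigma(\mathcal{H}_\Gamma)=\bigcup_j E_j(\mathbb{T}^d)$, and the sets $E_j(\mathbb{T}^d)$ are the spectral bands. *)

(* Defs.v *)
From HB Require Import structures.
From mathcomp Require Import all_boot all_order all_algebra.
From mathcomp Require Import complex.
From mathcomp Require Import all_classical all_reals all_analysis.

Set Implicit Arguments.
Unset Strict Implicit.
Unset Printing Implicit Defensive.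

Import Order.TTheory GRing.Theory Num.Theory.

Local Open Scope ring_scope.
Local Open Scope complex_scope.
Local Open Scope classical_set_scope.

(** * Periodic graphs *)

Definition lattice_vec (R : realType) (d : nat)
    (a : 'I_d -> 'rV[R]_d) (k : 'rV[int]_d) : 'rV[R]_d :=
  \sum_(i < d) (k 0 i)%:~R *: a i.

(* The unique representation makes the points [cell i] pairwise distinct. *)
Record periodic_vertices (R : realType) (d nu : nat) := PeriodicVertices {
  vset : set 'rV[R]_d;
  vset_countable : countable vset;
  period : 'I_d -> 'rV[R]_d;
  period_free : row_free (\matrix_(i < d) period i);
  cell : 'I_nu -> 'rV[R]_d;
  vset_repr : forall v, vset v ->
    exists! ik : 'I_nu * 'rV[int]_d, v = cell ik.1 + lattice_vec period ik.2;
  vset_cell : forall i k, vset (cell i + lattice_vec period k)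
}.

Definition vertex (R : realType) (d nu : nat) (X : periodic_vertices R d nu) :=
  set_type (vset X).

Section Vertices.
Context (R : realType) (d nu : nat) (X : periodic_vertices R d nu).

Lemma lattice_vec0 (a : 'I_d -> 'rV[R]_d) : lattice_vec a 0 = 0.
Proof. by rewrite /lattice_vec big1 // => i _; rewrite mxE mulr0z scale0r. Qed.

Lemma lattice_vecD (a : 'I_d -> 'rV[R]_d) k l :
  lattice_vec a (k + l) = lattice_vec a k + lattice_vec a l.
Proof.
rewrite /lattice_vec -big_split; apply: eq_bigr => i _ /=.
by rewrite mxE intrD scalerDl.
Qed.

Lemma cell_in (i : 'I_nu) : cell X i \in vset X.
Proof.
by rewrite inE -[cell X i]addr0 -(lattice_vec0 (period X)); exact: vset_cell.
Qed.

Lemma translate_in (v : vertex X) (k : 'rV[int]_d) :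
  val v + lattice_vec (period X) k \in vset X.
Proof.
have /set_mem/vset_repr [[i l] [-> _]] := valP v.
by rewrite inE -addrA -lattice_vecD; exact: vset_cell.
Qed.

Definition cell_vertex (i : 'I_nu) : vertex X := SigSub (cell_in i).

Definition translate (v : vertex X) (k : 'rV[int]_d) : vertex X :=
  SigSub (translate_in v k).

End Vertices.

Record periodic_graph (R : realType) (d nu : nat) := PeriodicGraph {
  vertices : periodic_vertices R d nu;
  weight : vertex vertices -> vertex vertices -> R;
  weight_ge0 : forall v v', 0 <= weight v v';
  weight_sym : forall v v', weight v v' = weight v' v;
  weight_diag : forall v, weight v v = 0;
  weight_summable : forall v,
    (\esum_(v' in [set: vertex vertices]) (weight v v')%:E < +oo)%E;
  weight_periodic : forall v v' k,
    weight (translate v k) (translate v' k) = weight v v';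
  potential : vertex vertices -> R;
  potential_periodic : forall v k, potential (translate v k) = potential v
}.

Definition graph_connected (R : realType) (d nu : nat)
    (G : periodic_graph R d nu) : Prop :=
  forall v v' : vertex (vertices G), exists p : seq (vertex (vertices G)),
    path (fun x y => 0 < weight x y) v p /\ last v p = v'.

(** * Sums and operators on l^2 *)

(* Sums of absolutely summable families, split into positive and negative
   parts; a family that is not absolutely summable gets a junk value. *)
Definition rsum (R : realType) (I : choiceType) (f : I -> R) : R :=
  fine (esum [set: I] (EFin \o f)^\+%E) - fine (esum [set: I] (EFin \o f)^\-%E).

Definition csum (R : realType) (I : choiceType) (f : I -> R[i]) : R[i] :=
  rsum (fun i => complex.Re (f i)) +i* rsum (fun i => complex.Im (f i)).

Section L2.
Context (R : realType) (I : choiceType).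
Implicit Types (f g : I -> R[i]) (T : (I -> R[i]) -> (I -> R[i])).

Definition l2_sqnorm f : \bar R :=
  (\esum_(i in [set: I]) (complex.Re `|f i| ^+ 2)%:E)%E.

Definition l2 : set (I -> R[i]) := [set f | l2_sqnorm f < +oo]%E.

Definition l2_norm f : R := Num.sqrt (fine (l2_sqnorm f)).

(* Operators on l^2(I) are represented by maps on all functions I -> R[i], of
   which only the restriction to l^2(I) matters. *)
Definition bounded_operator T : Prop :=
  [/\ forall f, l2 f -> l2 (T f),
      forall (a : R[i]) f g, l2 f -> l2 g ->
        T (fun i => a * f i + g i) = (fun i => a * T f i + T g i) &
      exists c : R, forall f, l2 f -> l2_norm (T f) <= c * l2_norm f].

Definition op_sub_scalar T (z : R[i]) f : I -> R[i] :=
  fun i => T f i - z * f i.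

Definition resolvent_set T : set R[i] :=
  [set z | exists S, bounded_operator S /\
    forall f, l2 f ->
      [/\ l2 (op_sub_scalar T z f), S (op_sub_scalar T z f) = f &
          op_sub_scalar T z (S f) = f]].

Definition spectrum T : set R[i] := ~` resolvent_set T.

Definition is_eigenvalue T (z : R[i]) : Prop :=
  exists f, [/\ l2 f, exists i, f i != 0 & T f = (fun i => z * f i)].

Definition is_max_spectrum T (m : R) : Prop :=
  spectrum T m%:C /\
  forall z, spectrum T z -> exists2 x : R, z = x%:C & x <= m.

End L2.

(** * The Schroedinger operator and its Floquet matrix *)

Section Operator.
Context (R : realType) (d nu : nat) (G : periodic_graph R d nu).

Definition adjacency (psi : vertex (vertices G) -> R[i]) :
    vertex (vertices G) -> R[i] :=
  fun v => csum (fun v' => (weight v v')%:C * psi v').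

Definition schroedinger (psi : vertex (vertices G) -> R[i]) :
    vertex (vertices G) -> R[i] :=
  fun v => adjacency psi v + (potential v)%:C * psi v.

Definition cis (x : R) : R[i] := cos x +i* sin x.

Definition cell_weight (i j : 'I_nu) (k : 'rV[int]_d) : R :=
  weight (cell_vertex (vertices G) i)
         (translate (cell_vertex (vertices G) j) k).

Definition cell_potential (i : 'I_nu) : R :=
  potential (cell_vertex (vertices G) i).

Definition dot_int (theta : 'rV[R]_d) (k : 'rV[int]_d) : R :=
  \sum_(i < d) theta 0 i * (k 0 i)%:~R.

(* A function on the torus R^d/Z^d is given by its Z^d-periodic lift to R^d,
   see [floquet_matrix_periodic] below. *)
Definition floquet_matrix (theta : 'rV[R]_d) : 'M[R[i]]_nu :=
  \matrix_(i, j)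
    (csum (fun k : 'rV[int]_d =>
             (cell_weight i j k)%:C * cis (2 * pi * dot_int theta k))
     + (cell_potential i)%:C *+ (i == j)).

Lemma floquet_matrix_periodic (theta : 'rV[R]_d) (m : 'rV[int]_d) :
  floquet_matrix (theta + map_mx intr m) = floquet_matrix theta.
Proof.
apply/matrixP => i j; rewrite !mxE; congr (_ + _); congr csum.
apply/funext => k; congr (_ * _); rewrite /dot_int.
pose s : int := \sum_(l < d) m 0 l * k 0 l.
have -> : \sum_(l < d) (theta + map_mx intr m) 0 l * (k 0 l)%:~R =
    \sum_(l < d) theta 0 l * (k 0 l)%:~R + s%:~R :> R.
  rewrite /s rmorph_sum -big_split /=; apply: eq_bigr => l _.
  by rewrite !mxE mulrDl intrM.
rewrite mulrDr; set x := 2 * pi * _.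
have cis_nat (y : R) n : cis (y + 2 * pi * n%:R) = cis y.
  by rewrite [2 * pi]mulr_natl mulr_natr /cis (periodicn (@cosD2pi R))
    (periodicn (@sinD2pi R)).
case: s => n; first exact: cis_nat.
by rewrite NegzE mulrNz mulrN -[LHS](cis_nat _ n.+1) subrK.
Qed.

(* Eigenvalues with algebraic multiplicity, in nondecreasing order.  They are
   real because the Floquet matrix is Hermitian. *)
Definition floquet_spectrum (theta : 'rV[R]_d) : seq R :=
  sort <=%R [seq complex.Re z |
    z <- sval (closed_field_poly_normal (char_poly (floquet_matrix theta)))].

(* Indexed from 0: [floquet_eigenvalue j] is E_(j+1). *)
Definition floquet_eigenvalue (j : nat) (theta : 'rV[R]_d) : R :=
  nth 0 (floquet_spectrum theta) j.

End Operator.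

(* Main.v *)
(** Let [H(theta)] be the Floquet matrix.  [H(0)] has nonnegative off-diagonal
    entries, so maximising its quadratic form gives an eigenvalue [E] with an
    eigenvector [u >= 0]; lifted periodically to the graph, it is a function
    [U] with [H U = E U], and connectedness forces [U > 0].

    Suppose that [H f = z f] with [Re z >= E] and that [|f| / U] attains its
    maximum.  Comparing [H f] with [H U] at a maximum point shows that [f / U],
    phases included, is constant along edges; hence [f] is a multiple of [U].
    An [l^2] eigenfunction for [E] attains the maximum, but multiples of [U]
    are not in [l^2].  If the top band were flat, a Bloch function with
    [theta = (1/2, 0, ..., 0)] would be such an [f], but it changes sign under
    the first period.

    The ground state [U] also gives [H <= E] on [l^2] (AM-GM on each edge),
    which makes [H - z] invertible off the half-line [z <= E].  Finally
    [f = U q^|k|], with [q] close to 1, satisfies [H f >= (E - e) f], so [E]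
    belongs to the spectrum. *)
Require Import Defs.
From HB Require Import structures.
From mathcomp Require Import all_boot all_order all_algebra.
From mathcomp Require Import finmap complex ring lra.
From mathcomp Require Import all_classical all_reals all_analysis.

Set Implicit Arguments.
Unset Strict Implicit.
Unset Printing Implicit Defensive.

Import Order.TTheory GRing.Theory Num.Theory.
Import numFieldNormedType.Exports.

Local Open Scope ring_scope.
Local Open Scope complex_scope.

(** The top of the spectrum is found without the band decomposition and without the spectral
    theorem: resolvents are built from a Neumann series. Weights and potential being real, [H] acts
    separately on real and imaginary parts, so the operator estimates are made for real-valued
    functions. The ground state [U] is bounded and bounded away from 0, hence not square summable.
    It therefore acts as a weight and never as an l^2 vector: in the form bound [H <= E], and in the
    comparison [|f| <= M * U]. That comparison asks for no summability of [f], so it covers l^2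
    eigenfunctions and Bloch functions alike. [floquet_spectrum] lists real parts of roots of the
    characteristic polynomial. The comparison accordingly admits a complex [z] with [Re z >= E]. If
    the top band were constantly [c], the value at [theta = 0] would give [E <= c], and any other
    [theta] would provide a root [z] with [Re z = c]. *)

Definition asum (R : realType) (I : choiceType) (f : I -> R) : Prop :=
  (\esum_(i in [set: I]) `|f i|%:E < +oo)%E.

(** * Absolutely summable real families *)

Section Sums.
Context (R : realType) (I : choiceType).
Implicit Types (f g h : I -> R) (s : seq I).

Lemma asum_le f g : (forall i, `|f i| <= `|g i|) -> asum g -> asum f.
Proof.
by move=> fg; apply: le_lt_trans; apply: le_esum => i _; rewrite lee_fin.
Qed.

Lemma asum_le_ge0 f g : (forall i, `|f i| <= g i) -> asum g -> asum f.
Proof.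
by move=> fg; apply: asum_le => i; apply: le_trans (fg i) (ler_norm _).
Qed.

Lemma asum_norm f : asum f -> asum (fun i => `|f i|).
Proof. by apply: asum_le => i; rewrite normr_id. Qed.

Lemma asumN f : asum f -> asum (fun i => - f i).
Proof. by apply: asum_le => i; rewrite normrN. Qed.

Lemma asumD f g : asum f -> asum g -> asum (fun i => f i + g i).
Proof.
move=> sf sg; apply: le_lt_trans (lte_add_pinfty sf sg).
rewrite -esumD; try by move=> i _; rewrite lee_fin.
by apply: le_esum => i _; rewrite -EFinD lee_fin ler_normD.
Qed.

Lemma asumB f g : asum f -> asum g -> asum (fun i => f i - g i).
Proof. by move=> sf /asumN; exact: asumD. Qed.

Lemma esum_le_fin f (C : R) : (forall i, 0 <= f i) ->
    (forall s, uniq s -> \sum_(i <- s) f i <= C) ->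
  (\esum_(i in [set: I]) (f i)%:E <= C%:E)%E.
Proof.
move=> f0 fC; apply: ge_ereal_sup => _ [X [finX _] <-].
by rewrite fsbig_finite// sumEFin lee_fin fC// fset_uniq.
Qed.

Lemma fin_le_esum f s : (forall i, 0 <= f i) -> uniq s ->
  ((\sum_(i <- s) f i)%:E <= \esum_(i in [set: I]) (f i)%:E)%E.
Proof.
move=> f0 us; apply: esum_ge; exists [set` s]%classic.
  by split => //; exact: finite_seq.
by rewrite -sumEFin fsbig_seq.
Qed.

Lemma asum_fin_le f (C : R) :
  (forall s, uniq s -> \sum_(i <- s) `|f i| <= C) -> asum f.
Proof. by move=> fC; apply: le_lt_trans (esum_le_fin _ fC) (ltry _). Qed.

Lemma asum_ge0E f : (forall i, 0 <= f i) ->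
  asum f <-> (\esum_(i in [set: I]) (f i)%:E < +oo)%E.
Proof.
by move=> f0; rewrite /asum; under eq_esum do rewrite ger0_norm//.
Qed.

Lemma rsum_ge0E f : (forall i, 0 <= f i) -> asum f ->
  (rsum f)%:E = (\esum_(i in [set: I]) (f i)%:E)%E.
Proof.
move=> f0 sf; rewrite /rsum.
rewrite (_ : (EFin \o f)^\+%E = EFin \o f); last first.
  by apply/funext => i; rewrite funeposE /= max_l // lee_fin.
rewrite (_ : (EFin \o f)^\-%E = fun=> 0%E); last first.
  by apply/funext => i; rewrite funenegE /= max_r // lee_fin oppr_le0.
rewrite [X in _ - fine X]esum1 //= subr0 fineK // ge0_fin_numE.
  exact: (asum_ge0E f0).1.
by apply: esum_ge0 => i _; rewrite lee_fin.
Qed.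

Lemma eq_rsum f g : f =1 g -> rsum f = rsum g.
Proof. by move=> /funext ->. Qed.

Lemma rsum_ge0 f : (forall i, 0 <= f i) -> 0 <= rsum f.
Proof.
move=> f0; rewrite /rsum.
rewrite (_ : (EFin \o f)^\-%E = fun=> 0%E); last first.
  by apply/funext => i; rewrite funenegE /= max_r // lee_fin oppr_le0.
by rewrite [X in _ - fine X]esum1 //= subr0 fine_ge0 // esum_ge0.
Qed.

Lemma rsum_le_fin f (C : R) : (forall i, 0 <= f i) ->
  (forall s, uniq s -> \sum_(i <- s) f i <= C) -> rsum f <= C.
Proof.
move=> f0 fC; rewrite -lee_fin rsum_ge0E //; first exact: esum_le_fin.
apply: (@asum_fin_le _ C) => s us.
by under eq_bigr do rewrite ger0_norm //; exact: fC.
Qed.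

Lemma fin_le_rsum f s : (forall i, 0 <= f i) -> asum f -> uniq s ->
  \sum_(i <- s) f i <= rsum f.
Proof. by move=> f0 sf us; rewrite -lee_fin rsum_ge0E // fin_le_esum. Qed.

Lemma le1_rsum f i : (forall i, 0 <= f i) -> asum f -> f i <= rsum f.
Proof. by move=> f0 sf; rewrite -(big_seq1 +%R i f) fin_le_rsum. Qed.

(** Any splitting into nonnegative summable families computes the sum, not only the canonical one of
    the definition. Additivity and homogeneity rest on this. *)
Lemma rsum_posB f g : (forall i, 0 <= f i) -> (forall i, 0 <= g i) ->
  asum f -> asum g -> rsum (fun i => f i - g i) = rsum f - rsum g.
Proof.
move=> f0 g0 sf sg.
have finE (h : I -> \bar R) : (forall i, 0 <= h i)%E -> summable [set: I] h ->
    (\esum_(i in [set: I]) h i)%E \is a fin_num.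
  move=> h0; rewrite summableE; congr (_ \is a _).
  by apply: eq_esum => i _; rewrite gee0_abs.
have sb : summable [set: I] ((EFin \o f) \- (EFin \o g))%E by exact: summableB.
apply: EFin_inj; rewrite [in RHS]EFinB (rsum_ge0E f0 sf) (rsum_ge0E g0 sg).
rewrite -esumB //; try by move=> i _; rewrite lee_fin.
rewrite /rsum EFinB.
by rewrite !fineK //; apply: finE => //;
  [exact: summable_funeneg|exact: summable_funepos].
Qed.

Lemma rsumN f : rsum (fun i => - f i) = - rsum f.
Proof.
rewrite /rsum opprB.
have -> : (EFin \o (fun i => - f i)%R)^\+%E = (EFin \o f)^\-%E.
  by apply/funext => i; rewrite funeposE funenegE.
have -> // : (EFin \o (fun i => - f i)%R)^\-%E = (EFin \o f)^\+%E.
by apply/funext => i; rewrite funeposE funenegE /= opprK.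
Qed.

Lemma rsum_posneg f : asum f ->
  [/\ asum (fun i => Num.max (f i) 0), asum (fun i => Num.max (- f i) 0) &
   rsum f = rsum (fun i => Num.max (f i) 0) - rsum (fun i =>
     Num.max (- f i) 0)].
Proof.
move=> sf.
have sp : asum (fun i => Num.max (f i) 0).
  by apply: asum_le sf => i; case: (leP (f i) 0) => // _; rewrite normr0.
have sn : asum (fun i => Num.max (- f i) 0).
  by apply: asum_le sf => i; case: (leP (- f i) 0); rewrite ?normr0 ?normrN.
split => //; rewrite -rsum_posB //; try by move=> i; rewrite le_max lexx orbT.
apply: eq_rsum => i; case: (leP (f i) 0) => fi.
  by rewrite max_l ?oppr_ge0 // sub0r opprK.
by rewrite max_r ?subr0 // oppr_le0 ltW.
Qed.

Lemma rsum_posD f g : (forall i, 0 <= f i) -> (forall i, 0 <= g i) ->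
  asum f -> asum g -> rsum (fun i => f i + g i) = rsum f + rsum g.
Proof.
move=> f0 g0 sf sg; apply: EFin_inj.
rewrite [in RHS]EFinD (rsum_ge0E f0 sf) (rsum_ge0E g0 sg) rsum_ge0E; first last.
- exact: asumD.
- by move=> i; rewrite addr_ge0.
by rewrite -esumD // => i _; rewrite lee_fin.
Qed.

Lemma rsumD f g : asum f -> asum g ->
  rsum (fun i => f i + g i) = rsum f + rsum g.
Proof.
move=> sf sg; have [sf1 sf2 ->] := rsum_posneg sf.
have [sg1 sg2 ->] := rsum_posneg sg.
have max0 h i : 0 <= Num.max (h i) 0 :> R by rewrite le_max lexx orbT.
rewrite addrACA -opprD -!rsum_posD -?rsum_posB //; try exact: asumD;
  try (by move=> i; apply: addr_ge0; rewrite le_max lexx orbT);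
  try by move=> i; rewrite le_max lexx orbT.
apply: eq_rsum => i.
by case: (leP (f i)); case: (leP (g i)); case: (leP (- f i));
   case: (leP (- g i)); lra.
Qed.

Lemma rsumB f g : asum f -> asum g ->
  rsum (fun i => f i - g i) = rsum f - rsum g.
Proof. by move=> sf sg; rewrite rsumD ?rsumN //; exact: asumN. Qed.

Lemma le_rsum f g : asum f -> asum g -> (forall i, f i <= g i) ->
  rsum f <= rsum g.
Proof.
by move=> sf sg fg; rewrite -subr_ge0 -rsumB // rsum_ge0 // => i;
  rewrite subr_ge0.
Qed.

Lemma asumZ (c : R) f : asum f -> asum (fun i => c * f i).
Proof.
move=> sf; apply: (@asum_fin_le _ (`|c| * rsum (fun i => `|f i|))) => s us.
under eq_bigr do rewrite normrM.
by rewrite -mulr_sumr ler_wpM2l // fin_le_rsum //; exact: asum_norm.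
Qed.

Lemma rsum0 : rsum (fun _ : I => 0 : R) = 0.
Proof.
apply/le_anti/andP; split; last exact: rsum_ge0.
by apply: rsum_le_fin => // s _; rewrite big1.
Qed.

Lemma rsumZ (c : R) f : asum f -> rsum (fun i => c * f i) = c * rsum f.
Proof.
have le_posZ a h : 0 <= a -> (forall i, 0 <= h i) -> asum h ->
    rsum (fun i => a * h i) <= a * rsum h.
  move=> a0 h0 sh; apply: rsum_le_fin => [i|s us]; first exact: mulr_ge0.
  by rewrite -mulr_sumr ler_wpM2l // fin_le_rsum.
have posZ a h : 0 <= a -> (forall i, 0 <= h i) -> asum h ->
    rsum (fun i => a * h i) = a * rsum h.
  rewrite le_eqVlt => /predU1P[<-{a} _ _|a0 h0 sh].
    by under eq_rsum do rewrite mul0r; rewrite rsum0 mul0r.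
  apply/le_anti/andP; split; first by rewrite le_posZ // ltW.
  (* The reverse inequality is the previous one for the scalar [a^-1] and the family [a * h]. *)
  rewrite -ler_pdivlMl //.
  apply: le_trans (le_posZ _ _ _ _ _); last exact: asumZ.
  - by under [leRHS]eq_rsum do rewrite mulKf ?gt_eqF//.
  - by rewrite invr_ge0 ltW.
  - by move=> i; rewrite mulr_ge0 // ltW.
have geZ a h : 0 <= a -> asum h -> rsum (fun i => a * h i) = a * rsum h.
  move=> a0 sh; have [s1 s2 ->] := rsum_posneg sh.
  have max0 k i : 0 <= Num.max (k i) 0 :> R by rewrite le_max lexx orbT.
  rewrite mulrBr -!posZ // -rsumB; try exact: asumZ.
  apply: eq_rsum => i; rewrite -mulrBr; congr (_ * _).
  by case: (leP (h i)); case: (leP (- h i)); lra.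
move=> sf; case: (leP 0 c) => [/geZ-> //|/ltW c0].
rewrite -[LHS]opprK -rsumN; under eq_rsum do rewrite -mulNr.
by rewrite geZ ?oppr_ge0 // mulNr opprK.
Qed.

Lemma rsum_ge0_eq0 f : (forall i, 0 <= f i) -> asum f -> rsum f <= 0 ->
  forall i, f i = 0.
Proof.
move=> f0 sf rf i; apply/le_anti; rewrite f0 andbT.
exact: le_trans (le1_rsum i f0 sf) rf.
Qed.

End Sums.

(** * Reindexing and Fubini for absolutely summable families *)

Section Fubini.
Context (R : realType).

Lemma asum_reindex (I J : choiceType) (e : I -> J) (f : J -> R) :
  bijective e -> asum f <-> asum (f \o e).
Proof.
move=> bij_e; rewrite /asum (reindex_esum [set: I] [set: J] e) //.
by rewrite setTT_bijective.
Qed.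

Lemma rsum_reindex (I J : choiceType) (e : I -> J) (f : J -> R) :
  bijective e -> rsum f = rsum (f \o e).
Proof.
rewrite -setTT_bijective => bij_e.
rewrite /rsum !(reindex_esum [set: I] [set: J] e _ bij_e).
by congr (fine _ - fine _); apply: eq_esum => i _; rewrite ?funeposE ?funenegE.
Qed.

Lemma asum_fin (I : finType) (f : I -> R) : asum f.
Proof.
apply: (@asum_fin_le _ _ _ (\sum_i `|f i|)) => s us.
by rewrite big_uniq //= [leRHS](bigID (mem s)) /= lerDl sumr_ge0.
Qed.

Lemma rsum_fin (I : finType) (f : I -> R) : rsum f = \sum_i f i.
Proof.
have posP (g : I -> R) : (forall i, 0 <= g i) -> rsum g = \sum_i g i.
  move=> g0; apply/le_anti/andP; split; last first.
    by rewrite fin_le_rsum // ?index_enum_uniq //; exact: asum_fin.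
  apply: rsum_le_fin => // s us.
  by rewrite big_uniq //= [leRHS](bigID (mem s)) /= lerDl sumr_ge0.
have [_ _ ->] := rsum_posneg (asum_fin f).
rewrite !posP; try by move=> i; rewrite le_max lexx orbT.
rewrite -sumrB; apply: eq_bigr => i _.
by case: (leP (f i)); case: (leP (- f i)); lra.
Qed.

Context (I J : choiceType).
Implicit Type F : I -> J -> R.

Lemma asum_pair_ge0 F : (forall i j, 0 <= F i j) -> (forall i, asum (F i)) ->
  asum (fun i => rsum (F i)) -> asum (fun p : I * J => F p.1 p.2).
Proof.
move=> F0 sF /(asum_ge0E (fun i => rsum_ge0 (F0 i))) srF; apply/asum_ge0E => //.
apply: le_lt_trans srF; under [leRHS]eq_esum do rewrite rsum_ge0E //.
rewrite esum_esum; last by move=> *; rewrite lee_fin.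
by rewrite (_ : setT `*`` _ = setT)%classic //; apply/seteqP; split.
Qed.

Lemma asum_row F i : asum (fun p : I * J => F p.1 p.2) -> asum (F i).
Proof.
move=> sF; pose C := rsum (fun p : I * J => `|F p.1 p.2|).
apply: (@asum_fin_le _ _ _ C) => s us.
rewrite -(big_map (fun j => (i, j)) predT (fun p => `|F p.1 p.2|)).
apply: fin_le_rsum => //; first exact: asum_norm.
by rewrite map_inj_uniq // => j j' [].
Qed.

Lemma rsum_pair_ge0 F : (forall i j, 0 <= F i j) ->
    asum (fun p : I * J => F p.1 p.2) ->
  asum (fun i => rsum (F i)) /\ rsum (fun i =>
    rsum (F i)) = rsum (fun p : I * J => F p.1 p.2).
Proof.
move=> F0 sF; have sFi i := asum_row i sF.
have E : (\esum_(i in [set: I]) (rsum (F i))%:E =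
          \esum_(p in [set: I * J]) (F p.1 p.2)%:E)%E.
  under eq_esum do rewrite rsum_ge0E //.
  rewrite esum_esum; last by move=> *; rewrite lee_fin.
  by rewrite (_ : setT `*`` _ = setT)%classic //; apply/seteqP; split.
have srF : asum (fun i => rsum (F i)).
  apply/asum_ge0E => [i|]; first exact: rsum_ge0.
  by rewrite E; exact: (asum_ge0E (fun p => F0 p.1 p.2)).1 sF.
split=> //; apply: EFin_inj; rewrite !rsum_ge0E // => i; exact: rsum_ge0.
Qed.

Lemma rsum_pair F : asum (fun p : I * J => F p.1 p.2) ->
  asum (fun i => rsum (F i)) /\ rsum (fun i =>
    rsum (F i)) = rsum (fun p : I * J => F p.1 p.2).
Proof.
move=> sF; have [sp sn ->] := rsum_posneg sF.
have max0 (K : Type) (h : K -> R) i : 0 <= Num.max (h i) 0.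
  by rewrite le_max lexx orbT.
have [ap <-] := rsum_pair_ge0 (fun i j => max0 _ (F i) j) sp.
have [an <-] := rsum_pair_ge0 (fun i j => max0 _ (fun j => - F i j) j) sn.
have rE i : rsum (F i) =
    rsum (fun j => Num.max (F i j) 0) - rsum (fun j => Num.max (- F i j) 0).
  by have [] := rsum_posneg (asum_row i sF).
under eq_rsum do rewrite rE.
by split; [under [X in asum X]funext do rewrite rE; exact: asumB|exact: rsumB].
Qed.

End Fubini.

Lemma rsum_swap (R : realType) (I J : choiceType) (F : I -> J -> R) :
    asum (fun p : I * J => F p.1 p.2) ->
  [/\ asum (fun i => rsum (F i)), asum (fun j => rsum (F^~ j)) &
   rsum (fun i => rsum (F i)) = rsum (fun j => rsum (F^~ j))].
Proof.
move=> sF; have [a1 ->] := rsum_pair sF.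
have bij : bijective (fun p : J * I => (p.2, p.1)).
  by exists (fun p => (p.2, p.1)) => -[].
have [a2 r2] := rsum_pair (F := fun j i => F i j) (proj1
  (asum_reindex _ bij) sF).
by split => //; rewrite r2 (rsum_reindex _ bij).
Qed.

(** * Weighted Cauchy-Schwarz inequality and geometric series *)

Section Weighted.
Context (R : realType).

(** Expand [sum_j w_j (x_j - m)^2 >= 0] at [m = S / W]. An upper bound [W] of the total weight is
    enough, because that weight occurs with the coefficient [m^2 >= 0]. *)
Lemma rsum_jensen (J : choiceType) (w x : J -> R) (W : R) : 0 < W ->
    (forall j, 0 <= w j) -> asum w -> rsum w <= W ->
    asum (fun j => w j * x j) -> asum (fun j => w j * x j ^+ 2) ->
  rsum (fun j => w j * x j) ^+ 2 <= W * rsum (fun j => w j * x j ^+ 2).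
Proof.
move=> W0 w0 sw wW s1 s2; set S := rsum _; set Q := rsum _.
pose m := S / W.
have : 0 <= rsum (fun j => w j * x j ^+ 2 + ((- 2 * m) *
  (w j * x j) + m ^+ 2 * w j)).
  apply: rsum_ge0 => j.
  rewrite (_ : _ + _ = w j * (x j - m) ^+ 2); last by ring.
  by rewrite mulr_ge0 // sqr_ge0.
rewrite rsumD //; last by apply: asumD; exact: asumZ.
rewrite rsumD; try exact: asumZ.
rewrite !rsumZ // -/S -/Q => H.
have : m ^+ 2 * rsum w <= m ^+ 2 * W by rewrite ler_wpM2l // sqr_ge0.
have -> : m ^+ 2 * W = S ^+ 2 / W.
  by rewrite /m; field; rewrite gt_eqF.
have : m * S = S ^+ 2 / W by rewrite /m expr2 mulrAC.
move=> A B; rewrite -ler_pdivrMl // [W^-1 * _]mulrC; lra.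
Qed.

Lemma nat_fin_le (f : nat -> R) (C : R) : (forall n, 0 <= f n) ->
    (forall n, \sum_(k < n) f k <= C) ->
  forall s, uniq s -> \sum_(k <- s) f k <= C.
Proof.
move=> f0 fC s us; apply: le_trans (fC (\max_(k <- s) k).+1).
set M := (\max_(k <- s) k).+1; rewrite -(big_mkord predT f).
rewrite [leRHS](bigID (mem s)) /= -[X in X + _]big_filter.
rewrite [X in _ <= X + _](_ : _ = \sum_(k <- s) f k).
  by rewrite lerDl sumr_ge0.
apply: perm_big; apply: uniq_perm => //.
  by rewrite filter_uniq // /index_iota iota_uniq.
move=> k; rewrite mem_filter mem_index_iota /=;
  case: (boolP (k \in s)) => //= ks.
by rewrite /M ltnS (big_rem k ks) /= leq_maxl.
Qed.

Lemma geometric_asum (q : R) : 0 <= q -> q < 1 ->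
  asum (fun n => q ^+ n) /\ rsum (fun n => q ^+ n) <= (1 - q)^-1.
Proof.
move=> q0 q1; have qX n : 0 <= q ^+ n by exact: exprn_ge0.
have fin s : uniq s -> \sum_(n <- s) q ^+ n <= (1 - q)^-1.
  apply: nat_fin_le => // n.
  rewrite -[leRHS]mulr1 ler_pdivlMl ?subr_gt0 //.
  have := subrX1 q n; have := qX n; lra.
split; last exact: rsum_le_fin.
by apply: (asum_fin_le (C := (1 - q)^-1)) => s us;
  under eq_bigr do rewrite ger0_norm //; exact: fin.
Qed.

Lemma asum_natS (f : nat -> R) : asum f -> asum (fun n => f n.+1).
Proof.
move=> sf; apply: (asum_fin_le (C := rsum (fun n => `|f n|))) => s us.
rewrite -(big_map S predT (fun n => `|f n|)) fin_le_rsum //.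
  exact: asum_norm.
by rewrite map_inj_uniq //; exact: succn_inj.
Qed.

Lemma rsum_natS (f : nat -> R) : asum f -> rsum f = f 0%N + rsum (fun n =>
  f n.+1).
Proof.
have pos (g : nat -> R) : (forall n, 0 <= g n) -> asum g ->
    rsum g = g 0%N + rsum (fun n => g n.+1).
  move=> g0 sg; have sg' := asum_natS sg.
  apply/le_anti/andP; split.
    apply: rsum_le_fin => //; apply: nat_fin_le => // -[|n].
      by rewrite big_ord0 addr_ge0 // rsum_ge0.
    rewrite big_ord_recl lerD2l.
    have -> : \sum_(i < n) g (lift ord0 i) = \sum_(i <- iota 0 n) g i.+1.
      by rewrite -[n in RHS]subn0 big_mkord; apply: eq_bigr.
    by rewrite fin_le_rsum // iota_uniq.
  rewrite -lerBrDl; apply: rsum_le_fin => // s us.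
  rewrite lerBrDl -(big_map S predT g).
  have := @fin_le_rsum _ _ g (0%N :: map S s) g0 sg.
  rewrite big_cons; apply=> /=; rewrite map_inj_uniq ?us ?andbT;
    last exact: succn_inj.
  by apply/mapP => -[].
move=> sf; have [sp sn ->] := rsum_posneg sf.
have [_ _ ->] := rsum_posneg (asum_natS sf).
rewrite (pos _ _ sp) => [|n]; last by rewrite le_max lexx orbT.
rewrite (pos _ _ sn) => [|n]; last by rewrite le_max lexx orbT.
by case: (leP (f 0%N)); case: (leP (- f 0%N)); lra.
Qed.

Lemma rsum_nat_tail (f : nat -> R) n : asum f ->
  asum (fun m => f (n + m)%N) /\
  rsum f = \sum_(m < n) f m + rsum (fun m => f (n + m)%N).
Proof.
move=> sf; elim: n => [|n [sn ->]]; first by rewrite big_ord0 add0r.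
have E : (fun m => f (n.+1 + m)%N) = (fun m => f (n + m.+1)%N).
  by apply/funext => m; rewrite addnS.
rewrite E; split; first exact: asum_natS sn.
by rewrite big_ord_recr /= -addrA; congr (_ + _); rewrite (rsum_natS sn) addn0.
Qed.

Lemma le0_geometric (x C q : R) : 0 <= q -> q < 1 ->
  (forall n, x <= C * q ^+ n) -> x <= 0.
Proof.
move=> q0 q1 H.
have cv : (geometric C q @ \oo --> (0 : R^o))%classic.
  by apply: cvg_geometric; rewrite ger0_norm.
apply/ler_addgt0Pr => e e0; rewrite add0r.
have /cvgrPdist_lt/(_ e e0)[n _ /(_ n (leqnn n))] := cv.
rewrite sub0r normrN => /ltW; apply: le_trans.
exact: le_trans (H n) (ler_norm _).
Qed.

End Weighted.

(** * Real square-summable families *)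

Section RealL2.
Context (R : realType) (I : choiceType).
Implicit Types f g h : I -> R.

Definition sqsum f := asum (fun i => f i ^+ 2).

Definition ip f g : R := rsum (fun i => f i * g i).

Lemma asum_mul f g : sqsum f -> sqsum g -> asum (fun i => f i * g i).
Proof.
move=> sf sg; apply: asum_le_ge0 (asumD sf sg) => i.
by rewrite ler_norml; apply/andP; split; nra.
Qed.

Lemma sqsum_lin f g (c : R) : sqsum f -> sqsum g ->
  sqsum (fun i => f i + c * g i).
Proof.
move=> sf sg; rewrite /sqsum.
apply: asum_le_ge0 (asumD (asumZ 2 sf) (asumZ (2 * c ^+ 2) sg)) => i.
by rewrite ger0_norm ?sqr_ge0 //; have := sqr_ge0 (f i - c * g i); nra.
Qed.

Lemma sqsum0 : sqsum (fun=> 0).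
Proof. by apply: (asum_fin_le (C := 0)) => s _; rewrite big1 // => i;
  rewrite expr0n normr0. Qed.

Lemma sqsumZ (c : R) f : sqsum f -> sqsum (fun i => c * f i).
Proof.
move=> sf; have := sqsum_lin c sqsum0 sf.
by congr sqsum; apply/funext => i; rewrite add0r.
Qed.

Lemma ipC f g : ip f g = ip g f.
Proof. by apply: eq_rsum => i; rewrite mulrC. Qed.

Lemma ip_linl f g h (c : R) : sqsum f -> sqsum g -> sqsum h ->
  ip (fun i => f i + c * g i) h = ip f h + c * ip g h.
Proof.
move=> sf sg sh; rewrite /ip -rsumZ; last exact: asum_mul.
rewrite -rsumD; [|exact: asum_mul|by apply: asumZ; exact: asum_mul].
by apply: eq_rsum => i; rewrite mulrDl mulrA.
Qed.

Lemma ip_linr f g h (c : R) : sqsum f -> sqsum g -> sqsum h ->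
  ip h (fun i => f i + c * g i) = ip h f + c * ip h g.
Proof. by move=> sf sg sh; rewrite ipC ip_linl // !(ipC h). Qed.

Lemma ip_ge0 f : 0 <= ip f f.
Proof. by apply: rsum_ge0 => i; rewrite -expr2 sqr_ge0. Qed.

Lemma sqr_le_ip f i : sqsum f -> f i ^+ 2 <= ip f f.
Proof.
move=> sf; rewrite expr2.
apply: (le1_rsum (f := fun i => f i * f i)) => [j|]; last exact: asum_mul.
by rewrite -expr2 sqr_ge0.
Qed.

Lemma ip_le0 f : sqsum f -> ip f f <= 0 -> f = fun=> 0.
Proof.
move=> sf f0; apply/funext => i; apply/eqP; rewrite -sqrf_eq0.
by rewrite eq_le sqr_ge0 andbT (le_trans (sqr_le_ip i sf)).
Qed.

Lemma ip_sqr_lin f g (c : R) : sqsum f -> sqsum g ->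
  ip (fun i => f i + c * g i) (fun i => f i + c * g i) =
  ip f f + 2 * c * ip f g + c ^+ 2 * ip g g.
Proof.
move=> sf sg; rewrite ip_linl // ?ip_linr // ?(ipC g f); last exact: sqsum_lin.
by ring.
Qed.

Lemma ip_sqr_lin_le f g (c : R) : sqsum f -> sqsum g ->
  ip (fun i => f i + c * g i) (fun i => f i + c * g i) <=
  2 * ip f f + 2 * c ^+ 2 * ip g g.
Proof.
move=> sf sg; have := ip_ge0 (fun i => f i + (- c) * g i).
rewrite !ip_sqr_lin // sqrrN; lra.
Qed.

(** This plays the role of completeness of l^2. The sum is taken pointwise, and Cauchy-Schwarz with
    weights [q^n] bounds its square by [(1 - q)^-1 * sum_n d_n(i)^2 / q^n]. Exchanging the sums over
    [i] and [n] leaves the geometric series of [D * q^n]. *)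
Lemma sqsum_series (d : nat -> I -> R) (q D : R) : 0 < q -> q < 1 ->
    (forall n, sqsum (d n)) -> (forall n, ip (d n) (d n) <= D * q ^+ n ^+ 2) ->
  [/\ forall i, asum (d^~ i), sqsum (fun i => rsum (d^~ i)) &
   ip (fun i => rsum (d^~ i)) (fun i => rsum (d^~ i)) <= (1 - q)^-1 *
     ((1 - q)^-1 * D)].
Proof.
move=> q0 q1 sd dD; have [sq rq] := geometric_asum (ltW q0) q1.
have D0 : 0 <= D by have := dD 0%N; rewrite expr0 expr1n mulr1;
  apply: le_trans; exact: ip_ge0.
have qX n : 0 < q ^+ n by exact: exprn_gt0.
have W0 : 0 < (1 - q)^-1 by rewrite invr_gt0 subr_gt0.
have le_d n i : d n i ^+ 2 <= D * q ^+ n ^+ 2.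
  exact: le_trans (sqr_le_ip i (sd n)) (dD n).
have pd i : asum (d^~ i).
  apply: asum_le_ge0 (asumZ (1 + D) sq) => n.
  rewrite -(@ler_pXn2r _ 2) ?nnegrE ?mulr_ge0 ?addr_ge0 ?(ltW (qX _)) //.
  rewrite real_normK ?num_real //; apply: le_trans (le_d n i) _.
  by rewrite exprMn ler_wpM2r ?sqr_ge0 //; nra.
have pairs : asum (fun p : nat * I => d p.1 p.2 ^+ 2 / q ^+ p.1).
  apply: (asum_pair_ge0 (F := fun n i => d n i ^+ 2 / q ^+ n)) => [n i|n|].
  - by rewrite divr_ge0 ?sqr_ge0 // ltW.
  - by under [X in asum X]funext do rewrite mulrC; apply: asumZ; exact: sd.
  apply: asum_le_ge0 (asumZ D sq) => n.
  rewrite ger0_norm; last by apply: rsum_ge0 => i;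
    rewrite divr_ge0 ?sqr_ge0 // ltW.
  under eq_rsum do rewrite mulrC; rewrite rsumZ; last exact: sd.
  rewrite ler_pdivrMl //; apply: le_trans (_ : ip (d n) (d n) <= _).
    by rewrite /ip; under [leRHS]eq_rsum do rewrite -expr2.
  by apply: le_trans (dD n) _; rewrite expr2 mulrCA.
have [s1 s2 swapE] := rsum_swap (F := fun n i => d n i ^+ 2 / q ^+ n) pairs.
have bnd i : rsum (d^~ i) ^+ 2 <= (1 - q)^-1 * rsum (fun n =>
  d n i ^+ 2 / q ^+ n).
  have dE n : d n i = q ^+ n * (d n i / q ^+ n) by rewrite mulrC divfK ?gt_eqF.
  have dE2 n : q ^+ n * (d n i / q ^+ n) ^+ 2 = d n i ^+ 2 / q ^+ n.
    by rewrite expr_div_n mulrCA [q ^+ n ^+ 2]expr2 invfM mulVKf ?gt_eqF.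
  rewrite (eq_rsum dE) -(eq_rsum dE2); apply: rsum_jensen => //.
  - by move=> n; exact: ltW.
  - by under [X in asum X]funext do rewrite -dE.
  under [X in asum X]funext do rewrite dE2.
  apply: (asum_row (F := fun i n => d n i ^+ 2 / q ^+ n)).
  have bij : bijective (fun p : I * nat => (p.2, p.1)) by exists (fun p =>
    (p.2, p.1)) => -[].
  exact: (asum_reindex _ bij).1 pairs.
have sf : sqsum (fun i => rsum (d^~ i)).
  by apply: asum_le_ge0 (asumZ (1 - q)^-1 s2) => i; rewrite ger0_norm ?sqr_ge0.
split=> //; rewrite /ip; under eq_rsum do rewrite -expr2.
apply: le_trans (le_rsum sf (asumZ _ s2) bnd) _.
rewrite rsumZ // ler_wpM2l ?(ltW W0) // -swapE.
have : rsum (fun n => rsum (fun i => d n i ^+ 2 / q ^+ n)) <= rsum (fun n =>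
  D * q ^+ n).
  apply: le_rsum => //; first exact: asumZ.
  move=> n; under eq_rsum do rewrite mulrC; rewrite rsumZ; last exact: sd.
  rewrite ler_pdivrMl //; apply: le_trans (_ : ip (d n) (d n) <= _).
    by rewrite /ip; under [leRHS]eq_rsum do rewrite -expr2.
  by apply: le_trans (dD n) _; rewrite expr2 mulrCA.
move/le_trans; apply; rewrite rsumZ // mulrC; exact: ler_wpM2r.
Qed.

(* The solution is the Neumann series of [t K = 1 - (1 - t K)], where
   [t = delta / M'] makes [1 - t K] a contraction. *)
Lemma coercive_solve (K : (I -> R) -> I -> R) (M delta : R) :
    (forall f, sqsum f -> sqsum (K f)) ->
    (forall f g c, sqsum f -> sqsum g ->
      K (fun i => f i + c * g i) = fun i => K f i + c * K g i) ->
    (forall f, sqsum f -> ip (K f) (K f) <= M * ip f f) ->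
    0 < delta -> (forall f, sqsum f -> delta * ip f f <= ip f (K f)) ->
  forall g, sqsum g -> exists2 f, sqsum f & K f = g.
Proof.
move=> Ksq Klin KM d0 Kd g sg.
(* Adding [delta ^+ 2] makes [M'] positive and ensures [e <= 1] below. *)
pose M' : R := `|M| + delta ^+ 2.
have d2 : 0 < delta ^+ 2 by rewrite exprn_gt0.
have M'0 : 0 < M' by rewrite ltr_wpDl.
have {}KM f : sqsum f -> ip (K f) (K f) <= M' * ip f f.
  move=> sf; apply: le_trans (KM f sf) _; rewrite ler_wpM2r ?ip_ge0 //.
  by apply: le_trans (ler_norm M) _; rewrite lerDl ltW.
pose t := delta / M'; have t0 : 0 < t by rewrite divr_gt0.
pose e := delta ^+ 2 / M'.
have e0 : 0 < e by rewrite divr_gt0.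
have e1 : e <= 1 by rewrite ler_pdivrMr // mul1r lerDr.
(* Coercivity and the bound on [K] give [|(1 - t K) h|^2 <= (1 - 2 e + e) |h|^2], and
   [1 - e <= (1 - e / 2)^2]. *)
pose q : R := 1 - e / 2.
have q0 : 0 < q by rewrite /q; lra.
have q1 : q < 1 by rewrite /q; lra.
pose d n := iter n (fun h i => h i + (- t) * K h i) (fun i => t * g i).
have sd n : sqsum (d n).
  elim: n => [|n IHn] /=; first exact: sqsumZ.
  by apply: sqsum_lin => //; exact: Ksq.
have dS n : ip (d n.+1) (d n.+1) <= q ^+ 2 * ip (d n) (d n).
  rewrite /= ip_sqr_lin //; last exact: Ksq.
  have H1 := Kd _ (sd n); have H2 := KM _ (sd n); have H3 := ip_ge0 (d n).
  set x := ip (d n) (d n) in H1 H2 H3 *; set y := ip (d n) (K (d n)) in H1 *.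
  set z := ip (K _) (K _) in H2 *.
  have A1 : t * (delta * x) <= t * y by rewrite ler_wpM2l // ltW.
  have A2 : t ^+ 2 * z <= t ^+ 2 * (M' * x) by rewrite ler_wpM2l // sqr_ge0.
  have E1 : t * (delta * x) = e * x by rewrite /t /e mulrA; congr (_ * _);
    rewrite mulrAC -expr2.
  have E2 : t ^+ 2 * (M' * x) = e * x.
    by rewrite /t /e; field; rewrite gt_eqF.
  rewrite E1 in A1; rewrite E2 in A2.
  have : 0 <= (e / 2) ^+ 2 * x by rewrite mulr_ge0 // sqr_ge0.
  by rewrite /q sqrrN; nra.
have dD n : ip (d n) (d n) <= ip (d 0%N) (d 0%N) * q ^+ n ^+ 2.
  elim: n => [|n IHn]; first by rewrite expr0 expr1n mulr1.
  apply: le_trans (dS n) _; rewrite [q ^+ n.+1]exprS exprMn mulrCA.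
  by rewrite ler_wpM2l // sqr_ge0.
set D := ip (d 0%N) (d 0%N) in dD.
pose f i := rsum (d^~ i); pose r n i := rsum (fun m => d (n + m)%N i).
have [pd sf _] := sqsum_series q0 q1 sd dD.
have sr n : sqsum (r n) /\ ip (r n) (r n) <= (1 - q)^-1 * ((1 - q)^-1 *
  (D * q ^+ n ^+ 2)).
  have [|_] := @sqsum_series (fun m => d (n + m)%N) q
    (D * q ^+ n ^+ 2) q0 q1 (fun m => sd _).
    by move=> m; apply: le_trans (dD _) _; rewrite exprD exprMn mulrA.
  by split.
pose s n i := \sum_(m < n) d m i.
have ss n : sqsum (s n) /\ (fun i => t * K (s n) i) = (fun i =>
  d 0%N i - d n i).
  elim: n => [|n [sn IHn]].
    have -> : s 0%N = fun=> 0 by apply/funext => i; rewrite /s big_ord0.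
    split; first exact: sqsum0.
    have := Klin _ _ (-1) sqsum0 sqsum0.
    have -> : (fun i : I => 0 + -1 * 0 : R) = fun=> 0 by apply/funext => i;
      rewrite mulr0 addr0.
    move=> K0; apply/funext => i; rewrite subrr.
    by rewrite (congr1 (fun k => k i) K0) mulN1r subrr mulr0.
  have -> : s n.+1 = fun i => s n i + 1 * d n i.
    by apply/funext => i; rewrite /s big_ord_recr /= mul1r.
  split; first exact: sqsum_lin.
  rewrite Klin //; apply/funext => i; move/(congr1 (fun k => k i)) : IHn => /=.
  by rewrite /d /= => IHn; rewrite mulrDr IHn; ring.
have fE n : f = fun i => s n i + 1 * r n i.
  by apply/funext => i; rewrite /f mul1r; have [_ ->] := rsum_nat_tail n (pd i).
exists f => //.
suff : (fun i => K f i + (-1) * g i) = fun=> 0.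
  move=> H; apply/funext => i; apply/eqP; rewrite -subr_eq0 -mulN1r.
  by rewrite (congr1 (fun k => k i) H).
apply: ip_le0; first by apply: sqsum_lin => //; exact: Ksq.
(* For every [n], the residual [K f - g] equals [K (r n) - t^-1 * d n], since [t * K (s n)]
   telescopes to [d 0 - d n] and [d 0 = t * g]. Both terms have squared norm of order [q^(2n)], so
   the residual vanishes. *)
pose C := 2 * M' * ((1 - q)^-1 * (1 - q)^-1 * D) + 2 * t^-1 ^+ 2 * D.
apply: (@le0_geometric _ _ C (q ^+ 2)).
- exact: sqr_ge0.
- by rewrite expr_lt1 // ltW.
move=> n; have [sn En] := ss n; have [srn Nrn] := sr n.
have -> : (fun i => K f i + (-1) * g i) = fun i => K (r n) i + (- t^-1) * d n i.
  rewrite {1}(fE n) Klin //; apply/funext => i;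
    move/(congr1 (fun k => k i)) : En => /=.
  rewrite -/(d n i) => En.
  have tn : t != 0 by rewrite gt_eqF.
  by apply: (mulfI tn); rewrite !mulrDr En; field.
apply: le_trans (ip_sqr_lin_le _ (Ksq _ srn) (sd n)) _.
rewrite sqrrN -exprM mulnC exprM.
have := KM _ srn; have := dD n; set x := ip (d n) _; set y := ip (K _) _.
set z := ip (r n) _ in Nrn * => Hx Hy.
have B1 : M' * z <= M' * ((1 - q)^-1 * ((1 - q)^-1 * (D * q ^+ n ^+ 2)))
  by rewrite ler_wpM2l // ltW.
have B2 : t^-1 ^+ 2 * x <= t^-1 ^+ 2 * (D * q ^+ n ^+ 2)
  by rewrite ler_wpM2l // sqr_ge0.
rewrite /C; set a := (1 - q)^-1 in B1 *; set Q := q ^+ n ^+ 2 in B1 B2 *; lra.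
Qed.

End RealL2.

(** * Weighted adjacency operators with a positive ground state *)

Section SchurOperator.
Context (R : realType) (I : choiceType) (w : I -> I -> R) (U Q : I -> R).
Context (E W Qm : R).
Hypothesis w_ge0 : forall i j, 0 <= w i j.
Hypothesis w_sym : forall i j, w i j = w j i.
Hypothesis w_row : forall i, asum (w i).
Hypothesis W_gt0 : 0 < W.
Hypothesis w_rowW : forall i, rsum (w i) <= W.
Hypothesis Q_bound : forall i, `|Q i| <= Qm.
Hypothesis U_gt0 : forall i, 0 < U i.
Hypothesis wU_row : forall i, asum (fun j => w i j * U j).
Hypothesis HU : forall i, rsum (fun j => w i j * U j) = (E - Q i) * U i.
Implicit Types f g : I -> R.

Definition adj_op f i : R := rsum (fun j => w i j * f j).

Definition schr_op f i : R := adj_op f i + Q i * f i.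

Lemma adj_row_asum f i : sqsum f -> asum (fun j => w i j * f j).
Proof.
move=> sf; apply: asum_le_ge0 (asumZ (1 + ip f f) (w_row i)) => j.
rewrite normrM ger0_norm // mulrC ler_wpM2r //.
have := sqr_le_ip j sf; have := sqr_ge0 (`|f j| - 1).
rewrite -(real_normK (num_real (f j))); have := ip_ge0 f; nra.
Qed.

Lemma pair_swap_bij (A B : Type) : bijective (fun p : A * B => (p.2, p.1)).
Proof. by exists (fun p => (p.2, p.1)) => -[]. Qed.

Lemma adj_pair_asum f : sqsum f ->
  asum (fun p : I * I => w p.1 p.2 * f p.1 ^+ 2) /\
  asum (fun p : I * I => w p.1 p.2 * f p.2 ^+ 2).
Proof.
move=> sf.
have s1 : asum (fun p : I * I => w p.1 p.2 * f p.1 ^+ 2).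
  apply: (asum_pair_ge0 (F := fun i j => w i j * f i ^+ 2)) => [i j|i|].
  - by rewrite mulr_ge0 // sqr_ge0.
  - by under [X in asum X]funext do rewrite mulrC; exact: asumZ.
  apply: asum_le_ge0 (asumZ W sf) => i.
  under eq_rsum do rewrite mulrC; rewrite rsumZ // ger0_norm.
    by rewrite mulrC ler_wpM2r // sqr_ge0.
  by rewrite mulr_ge0 ?sqr_ge0 // rsum_ge0.
split=> //; have := (asum_reindex _ (pair_swap_bij I I)).1 s1.
by congr asum; apply/funext => p /=; rewrite w_sym.
Qed.

(** The Schur test: Cauchy-Schwarz in each row, then an exchange of sums, after which symmetry lets
    the row bound [W] serve for the columns. *)
Lemma adj_sqsum f : sqsum f ->
  sqsum (adj_op f) /\ ip (adj_op f) (adj_op f) <= W ^+ 2 * ip f f.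
Proof.
move=> sf; have [_ s2] := adj_pair_asum sf.
have [a1 a2 swapE] := rsum_swap (F := fun i j => w i j * f j ^+ 2) s2.
have bnd i : adj_op f i ^+ 2 <= W * rsum (fun j => w i j * f j ^+ 2).
  apply: rsum_jensen => //; first exact: adj_row_asum.
  exact: (asum_row (F := fun i j => w i j * f j ^+ 2)).
have sA : sqsum (adj_op f).
  by apply: asum_le_ge0 (asumZ W a1) => i; rewrite ger0_norm ?sqr_ge0.
split=> //; rewrite /ip; under eq_rsum do rewrite -expr2.
apply: le_trans (le_rsum sA (asumZ _ a1) bnd) _.
rewrite rsumZ // [W ^+ 2]expr2 -mulrA ler_wpM2l ?(ltW W_gt0) // swapE.
rewrite -rsumZ; last exact: asum_mul.
apply: le_rsum => //; first by apply: asumZ; exact: asum_mul.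
move=> j; rewrite -expr2.
have -> : (fun i => w i j * f j ^+ 2) = (fun i => f j ^+ 2 * w j i).
  by apply/funext => i; rewrite mulrC w_sym.
by rewrite rsumZ // mulrC ler_wpM2r // sqr_ge0.
Qed.

Lemma adj_sym f g : sqsum f -> sqsum g -> ip (adj_op f) g = ip f (adj_op g).
Proof.
move=> sf sg; have [_ sf2] := adj_pair_asum sf;
  have [sg1 _] := adj_pair_asum sg.
have sF : asum (fun p : I * I => w p.1 p.2 * f p.2 * g p.1).
  apply: asum_le_ge0 (asumD sf2 sg1) => -[i j] /=.
  rewrite -mulrA normrM ger0_norm // -mulrDr ler_wpM2l // ler_norml.
  by apply/andP; split; nra.
have [_ _ swapE] := rsum_swap (F := fun i j => w i j * f j * g i) sF.
rewrite /ip /adj_op; transitivity (rsum (fun i => rsum (fun j =>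
  w i j * f j * g i))).
  apply: eq_rsum => i; rewrite mulrC -rsumZ; last exact: adj_row_asum.
  by apply: eq_rsum => j; rewrite mulrC.
rewrite swapE; apply: eq_rsum => j; rewrite -rsumZ; last exact: adj_row_asum.
by apply: eq_rsum => i; rewrite w_sym; ring.
Qed.

(** On each edge [f_i f_j] is at most half of [U_j f_i^2 / U_i + U_i f_j^2 / U_j]. These
    coefficients are chosen so that [HU] evaluates the row sums exactly, and the two halves have the
    same double sum by symmetry of [w]. *)
Lemma adj_form f : sqsum f ->
  ip f (adj_op f) <= rsum (fun i => (E - Q i) * f i ^+ 2).
Proof.
move=> sf; have [sf1 sf2] := adj_pair_asum sf.
have rowE i : rsum (fun j => w i j * U j * (f i ^+ 2 / U i)) =
  (E - Q i) * f i ^+ 2.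
  under eq_rsum do rewrite mulrC; rewrite rsumZ // HU mulrC -!mulrA;
    congr (_ * _).
  by field; rewrite gt_eqF.
have sT : asum (fun i => (E - Q i) * f i ^+ 2).
  apply: asum_le_ge0 (asumZ (`|E| + Qm) sf) => i.
  rewrite normrM (ger0_norm (sqr_ge0 _)) ler_wpM2r ?sqr_ge0 //.
  by rewrite (le_trans (ler_normB _ _)) // lerD2l.
have s1 : asum (fun p : I * I => w p.1 p.2 * U p.2 * (f p.1 ^+ 2 / U p.1)).
  apply: (asum_pair_ge0 (F := fun i j => w i j * U j * (f i ^+ 2 / U i))) =>
    [i j|i|].
  - by rewrite mulr_ge0 //; [rewrite mulr_ge0 // ltW|rewrite divr_ge0 ?sqr_ge0
      // ltW].
  - by under [X in asum X]funext do rewrite mulrC; exact: asumZ.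
  by under [X in asum X]funext do rewrite rowE.
have s2 : asum (fun p : I * I => w p.1 p.2 * U p.1 * (f p.2 ^+ 2 / U p.2)).
  have := (asum_reindex _ (pair_swap_bij I I)).1 s1.
  by congr asum; apply/funext => p /=; rewrite w_sym.
have [a1 r1] := rsum_pair (F := fun i j => w i j * U j * (f i ^+ 2 / U i)) s1.
have r2 : rsum (fun p : I * I => w p.1 p.2 * U p.1 * (f p.2 ^+ 2 / U p.2)) =
          rsum (fun p : I * I => w p.1 p.2 * U p.2 * (f p.1 ^+ 2 / U p.1)).
  rewrite [RHS](rsum_reindex _ (pair_swap_bij I I)).
  by apply: eq_rsum => p /=; rewrite w_sym.
have sF : asum (fun p : I * I => f p.1 * (w p.1 p.2 * f p.2)).
  apply: asum_le_ge0 (asumD sf1 sf2) => -[i j] /=.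
  rewrite mulrCA normrM ger0_norm // -mulrDr ler_wpM2l // ler_norml.
  by apply/andP; split; nra.
have [_ r3] := rsum_pair (F := fun i j => f i * (w i j * f j)) sF.
have -> : ip f (adj_op f) = rsum (fun p : I * I => f p.1 * (w p.1 p.2 * f p.2)).
  rewrite -r3; apply: eq_rsum => i; rewrite rsumZ //; exact: adj_row_asum.
rewrite -(eq_rsum rowE) {}r1.
set X := (X in _ <= X) in r2 *; have -> : X = rsum (fun p : I * I =>
    2^-1 * (w p.1 p.2 * U p.2 * (f p.1 ^+ 2 / U p.1)
            + w p.1 p.2 * U p.1 * (f p.2 ^+ 2 / U p.2))).
  rewrite rsumZ; last exact: asumD.
  by rewrite rsumD // r2 -/X; lra.
apply: le_rsum => //; first by apply: asumZ; exact: asumD.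
move=> [i j] /=; have ui := U_gt0 i; have uj := U_gt0 j.
rewrite -subr_ge0 (_ : _ - _ =
  w i j * (U i * U j / 2) * (f i / U i - f j / U j) ^+ 2); last first.
  by field; rewrite !gt_eqF.
by rewrite mulr_ge0 ?sqr_ge0 // mulr_ge0 // divr_ge0 // mulr_ge0 // ltW.
Qed.

Lemma mulQ_sqsum f : sqsum f -> sqsum (fun i => Q i * f i) /\
  ip (fun i => Q i * f i) (fun i => Q i * f i) <= Qm ^+ 2 * ip f f.
Proof.
move=> sf.
have bnd i : (Q i * f i) ^+ 2 <= Qm ^+ 2 * f i ^+ 2.
  rewrite exprMn ler_wpM2r ?sqr_ge0 // -(real_normK (num_real (Q i))).
  by rewrite ler_pXn2r // nnegrE // (le_trans _ (Q_bound i)).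
have s1 : sqsum (fun i => Q i * f i).
  by apply: asum_le_ge0 (asumZ (Qm ^+ 2) sf) => i; rewrite ger0_norm ?sqr_ge0.
split=> //; rewrite /ip -rsumZ; last exact: asum_mul.
apply: le_rsum; [exact: asum_mul|by apply: asumZ; exact: asum_mul|].
by move=> i; rewrite -!expr2.
Qed.

Lemma schr_sqsum f : sqsum f -> sqsum (schr_op f).
Proof.
move=> sf; have [s1 _] := adj_sqsum sf; have [s2 _] := mulQ_sqsum sf.
have := sqsum_lin 1 s1 s2; congr sqsum.
by apply/funext => i; rewrite mul1r.
Qed.

Lemma schr_bound f : sqsum f ->
  ip (schr_op f) (schr_op f) <= (2 * W ^+ 2 + 2 * Qm ^+ 2) * ip f f.
Proof.
move=> sf; have [s1 b1] := adj_sqsum sf; have [s2 b2] := mulQ_sqsum sf.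
have := ip_sqr_lin_le 1 s1 s2; rewrite expr1n.
have -> : (fun i => adj_op f i + 1 * (Q i * f i)) = schr_op f.
  by apply/funext => i; rewrite mul1r.
lra.
Qed.

Lemma schr_lin f g (b c : R) : sqsum f -> sqsum g ->
  schr_op (fun i => b * f i + c * g i) =
  fun i => b * schr_op f i + c * schr_op g i.
Proof.
move=> sf sg; apply/funext => i; rewrite /schr_op /adj_op.
have -> : (fun j => w i j * (b * f j + c * g j)) =
          (fun j => b * (w i j * f j) + c * (w i j * g j)).
  by apply/funext => j; ring.
have af := adj_row_asum i sf; have ag := adj_row_asum i sg.
by rewrite rsumD ?rsumZ //; try exact: asumZ; ring.
Qed.

Lemma schr_sym f g : sqsum f -> sqsum g -> ip (schr_op f) g = ip f (schr_op g).
Proof.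
move=> sf sg; have [sf1 _] := adj_sqsum sf; have [sg1 _] := adj_sqsum sg.
have [sf2 _] := mulQ_sqsum sf; have [sg2 _] := mulQ_sqsum sg.
have -> : schr_op f = fun i => adj_op f i + 1 * (Q i * f i).
  by apply/funext => i; rewrite mul1r.
have -> : schr_op g = fun i => adj_op g i + 1 * (Q i * g i).
  by apply/funext => i; rewrite mul1r.
rewrite ip_linl // ip_linr // adj_sym //; congr (_ + _ * _).
by apply: eq_rsum => i; ring.
Qed.

Lemma schr_form f : sqsum f -> ip f (schr_op f) <= E * ip f f.
Proof.
move=> sf; have [sf1 _] := adj_sqsum sf; have [sf2 _] := mulQ_sqsum sf.
have -> : schr_op f = fun i => adj_op f i + 1 * (Q i * f i).
  by apply/funext => i; rewrite mul1r.
rewrite ip_linr // mul1r -lerBrDr; apply: le_trans (adj_form sf) _.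
have ff := asum_mul sf sf; have fQ := asum_mul sf sf2.
rewrite /ip -rsumZ // -rsumB //; last exact: asumZ.
by rewrite le_eqVlt; apply/orP; left; apply/eqP/eq_rsum => i; ring.
Qed.

(** The operator [H - x], written with [+ (- x) *] so that the lemmas on [f + c * g] apply
    directly. *)
Definition shift_op (x : R) f i : R := schr_op f i + (- x) * f i.

Lemma shift_sqsum x f : sqsum f -> sqsum (shift_op x f).
Proof. by move=> sf; apply: sqsum_lin => //; exact: schr_sqsum. Qed.

Lemma shift_bound x f : sqsum f ->
  ip (shift_op x f) (shift_op x f) <=
  (2 * (2 * W ^+ 2 + 2 * Qm ^+ 2) + 2 * x ^+ 2) * ip f f.
Proof.
move=> sf; apply: le_trans (ip_sqr_lin_le _ (schr_sqsum sf) sf) _.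
by have := schr_bound sf; rewrite sqrrN; lra.
Qed.

Lemma shift_lin x f g (b c : R) : sqsum f -> sqsum g ->
  shift_op x (fun i => b * f i + c * g i) =
  fun i => b * shift_op x f i + c * shift_op x g i.
Proof.
by move=> sf sg; apply/funext => i; rewrite /shift_op schr_lin //; ring.
Qed.

Lemma shift_sym x f g : sqsum f -> sqsum g ->
  ip (shift_op x f) g = ip f (shift_op x g).
Proof.
move=> sf sg; have sHf := schr_sqsum sf; have sHg := schr_sqsum sg.
by rewrite ip_linl // ip_linr // schr_sym.
Qed.

Lemma shift_form x f : sqsum f -> ip f (shift_op x f) <= (E - x) * ip f f.
Proof.
move=> sf; have sHf := schr_sqsum sf.
by rewrite ip_linr // mulNr mulrBl lerD2r schr_form.
Qed.

(** By the form bound, [x - H] is coercive with constant [x - E]. The equation is solved for this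
    operator, so both sides change sign. *)
Lemma shift_solve_real x g : E < x -> sqsum g ->
  exists2 f, sqsum f & shift_op x f = g.
Proof.
move=> Ex sg.
have [|||||f sf fE] := @coercive_solve _ _ (fun f i => (-1) * shift_op x f i)
  (2 * (2 * W ^+ 2 + 2 * Qm ^+ 2) + 2 * x ^+ 2) (x - E) _ _ _ _ _
  (fun i => (-1) * g i) (sqsumZ _ sg).
- by move=> f sf; apply: sqsumZ; exact: shift_sqsum.
- move=> f h c sf sh; apply/funext => i.
  have := shift_lin x 1 c sf sh; under eq_fun do rewrite mul1r.
  by move=> ->; ring.
- move=> f sf; apply: le_trans (shift_bound x sf).
  by rewrite le_eqVlt; apply/orP; left; apply/eqP/eq_rsum => i; ring.
- by rewrite subr_gt0.
- move=> f sf; have := shift_form x sf.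
  have -> : ip f (fun i => -1 * shift_op x f i) = - ip f (shift_op x f).
    by rewrite /ip -rsumN; apply: eq_rsum => i; ring.
  lra.
exists f => //; apply/funext => i; move/(congr1 (fun k => k i)) : fE => /=.
by rewrite !mulN1r => /oppr_inj.
Qed.

(* Inverting [A ^ 2 + y ^ 2 = (A - i y) (A + i y)] solves the equation at the
   nonreal point [x + i y] within real-valued functions. *)
Lemma shift_solve_sqr (x y : R) g : y != 0 -> sqsum g ->
  exists2 f, sqsum f & (fun i => shift_op x
    (shift_op x f) i + y ^+ 2 * f i) = g.
Proof.
move=> y0; pose C := 2 * (2 * W ^+ 2 + 2 * Qm ^+ 2) + 2 * x ^+ 2.
have C0 : 0 <= C.
  by have := sqr_ge0 W; have := sqr_ge0 Qm; have := sqr_ge0 x; rewrite /C; lra.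
apply: (@coercive_solve _ _ _ (2 * C ^+ 2 + 2 * y ^+ 2 ^+ 2) (y ^+ 2)).
- by move=> f sf; apply: sqsum_lin => //; do 2!apply: shift_sqsum.
- move=> f h c sf sh; apply/funext => i.
  have sAf := shift_sqsum x sf; have sAh := shift_sqsum x sh.
  have := shift_lin x 1 c sf sh; under eq_fun do rewrite mul1r.
  move=> ->; under [X in shift_op x X]eq_fun do rewrite mul1r.
  have := shift_lin x 1 c sAf sAh; under [X in shift_op x X]eq_fun
    do rewrite mul1r.
  by move=> ->; ring.
- move=> f sf; have sAf := shift_sqsum x sf.
  apply: le_trans (ip_sqr_lin_le _ (shift_sqsum x sAf) sf) _.
  have := shift_bound x sAf; have := shift_bound x sf; rewrite -/C => H1 H2.
  have : C * ip (shift_op x f) (shift_op x f) <= C * (C * ip f f)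
    by rewrite ler_wpM2l.
  lra.
- by rewrite lt_neqAle eq_sym sqrf_eq0 y0 sqr_ge0.
move=> f sf; have sAf := shift_sqsum x sf.
rewrite ip_linr //; last exact: shift_sqsum.
(* Symmetry turns the form of the square [A (A f)] into [ip (A f) (A f) >= 0], so the term [y ^+ 2]
   alone gives coercivity. *)
by rewrite -shift_sym // lerDr ip_ge0.
Qed.

(* [w i j * (M * U j - Re (f j * conj (f i) / |f i|))] is nonnegative and sums
   to [(E - Re z) * M * U i <= 0] over [j], so every term vanishes. *)
Lemma max_principle (f : I -> R[i]) (z : R[i]) (M : R) i :
    E <= complex.Re z -> 0 < M ->
    (forall j, complex.Re (f j) ^+ 2 + complex.Im (f j) ^+ 2 <=
      (M * U j) ^+ 2) ->
    complex.Re (f i) ^+ 2 + complex.Im (f i) ^+ 2 = (M * U i) ^+ 2 ->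
    csum (fun j => (w i j)%:C * f j) + (Q i)%:C * f i = z * f i ->
  forall j, 0 < w i j -> f j * (U i)%:C = f i * (U j)%:C.
Proof.
case: z => x y /= Ex M0 fM fi.
pose a j := complex.Re (f j); pose b j := complex.Im (f j).
have fE j : f j = a j +i* b j by rewrite /a /b; case: (f j).
rewrite -/(a i) -/(b i) in fi.
have {}fM j : a j ^+ 2 + b j ^+ 2 <= (M * U j) ^+ 2 := fM j.
rewrite /csum.
have -> : (fun j => complex.Re ((w i j)%:C * f j)) = fun j => w i j * a j.
  by apply/funext => j; rewrite fE /=; ring.
have -> : (fun j => complex.Im ((w i j)%:C * f j)) = fun j => w i j * b j.
  by apply/funext => j; rewrite fE /=; ring.
rewrite {1 2}fE => /eqP; rewrite eq_complex /= => /andP[/eqP Ea /eqP Eb] j wij.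
have MU k : 0 < M * U k by rewrite mulr_gt0.
have le_abs k (u v : R) : u ^+ 2 + v ^+ 2 <= (M * U k) ^+ 2 -> `|u| <= M * U k.
  move=> uv; rewrite -(@ler_pXn2r _ 2) ?nnegrE ?(ltW
    (MU k)) // real_normK ?num_real //.
  by apply: le_trans uv; rewrite lerDl sqr_ge0.
have sMU : asum (fun k => M * (w i k * U k)) by exact: asumZ.
have sa : asum (fun k => w i k * a k).
  apply: asum_le_ge0 sMU => k; rewrite mulrCA normrM ger0_norm // ler_wpM2l //.
  exact: le_abs (fM k).
have sb : asum (fun k => w i k * b k).
  apply: asum_le_ge0 sMU => k; rewrite mulrCA normrM ger0_norm // ler_wpM2l //.
  by apply: (le_abs k _ (a k)); rewrite addrC.
(* [al + i be] is the phase of [f i]; it has modulus 1 because [|f i| = M * U i]. *)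
pose al := a i / (M * U i); pose be := b i / (M * U i).
have MUi := MU i.
have ab1 : al ^+ 2 + be ^+ 2 = 1.
  by rewrite /al /be !expr_div_n -mulrDl fi mulfV // gt_eqF // exprn_gt0.
have aE : a i = M * U i * al by rewrite mulrC divfK // gt_eqF.
have bE : b i = M * U i * be by rewrite mulrC divfK // gt_eqF.
have c_le k : al * a k + be * b k <= M * U k.
  have := fM k; have := MU k; set m := M * U k => m0 H.
  have := sqr_ge0 (a k - m * al); have := sqr_ge0 (b k - m * be).
  rewrite leNgt => A B; apply/negP => cm; nra.
pose s k := M * (w i k * U k) - (al * (w i k * a k) + be * (w i k * b k)).
have s_ge0 k : 0 <= s k.
  rewrite (_ : s k = w i k * (M * U k - (al * a k + be * b k)));
    last by rewrite /s; ring.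
  by rewrite mulr_ge0 // subr_ge0.
have sab : asum (fun k => al * (w i k * a k) + be * (w i k * b k)).
  by apply: asumD; exact: asumZ.
have rs : rsum s <= 0.
  rewrite /s rsumB // rsumZ // HU rsumD; try exact: asumZ.
  rewrite !rsumZ //.
  have -> : rsum (fun k => w i k * a k) = x * a i - y * b i - Q i * a i by lra.
  have -> : rsum (fun k => w i k * b k) = x * b i + y * a i - Q i * b i by lra.
  (* Projecting the eigenvalue equation on the phase of [f i] isolates [Re z = x]: the factor of
     [Im z = y] is [be * a i - al * b i], which is zero. *)
  rewrite (_ : _ - _ = (E - Q i) * (M * U i) - (x - Q i) * (al * a i + be * b i)
     - y * (be * a i - al * b i)); last by ring.
  have -> : be * a i - al * b i = 0 by rewrite aE bE; ring.
  have -> : al * a i + be * b i = M * U i.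
    by rewrite aE bE -[RHS]mulr1 -ab1; ring.
  have : 0 <= (x - E) * (M * U i) by rewrite mulr_ge0 ?subr_ge0 // ltW.
  lra.
have := rsum_ge0_eq0 s_ge0 (asumB sMU sab) rs j.
rewrite (_ : s j = w i j * (M * U j - (al * a j + be * b j)));
  last by rewrite /s; ring.
move=> /eqP; rewrite mulf_eq0 gt_eqF //= subr_eq0 => /eqP cj.
(* Equality case of Cauchy-Schwarz: the squared distance from [f j] to [M * U j] times the phase is
   [|f j|^2 - (M * U j)^2], which is nonpositive. *)
have S : (a j - M * U j * al) ^+ 2 + (b j - M * U j * be) ^+ 2 =
    a j ^+ 2 + b j ^+ 2 - (M * U j) ^+ 2.
  transitivity (a j ^+ 2 + b j ^+ 2 - 2 * (M * U j) * (al * a j + be * b j) +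
    (M * U j) ^+ 2 * (al ^+ 2 + be ^+ 2)); first by ring.
  by rewrite -cj ab1; ring.
have aj : a j = M * U j * al.
  apply/eqP; rewrite -subr_eq0 -sqrf_eq0 eq_le sqr_ge0 andbT.
  by have := fM j; have := sqr_ge0 (b j - M * U j * be); lra.
have bj : b j = M * U j * be.
  apply/eqP; rewrite -subr_eq0 -sqrf_eq0 eq_le sqr_ge0 andbT.
  by have := fM j; have := sqr_ge0 (a j - M * U j * al); lra.
rewrite !fE; apply/eqP; rewrite eq_complex /= aj bj aE bE.
by apply/andP; split; apply/eqP; ring.
Qed.

End SchurOperator.

(** * Spectra on l^2 *)

Section ComplexL2.
Context (R : realType) (I : choiceType).
Implicit Types (f g : I -> R[i]).

Definition csq f : R :=
  ip (fun i => complex.Re (f i)) (fun i => complex.Re (f i)) +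
  ip (fun i => complex.Im (f i)) (fun i => complex.Im (f i)).

Lemma re_norm_sqr (z : R[i]) :
  complex.Re `|z| ^+ 2 = complex.Re z ^+ 2 + complex.Im z ^+ 2.
Proof.
by case: z => a b /=; rewrite sqr_sqrtr // addr_ge0 // sqr_ge0.
Qed.

Lemma l2_sqnormE f : l2_sqnorm f =
  (\esum_(i in [set: I]) (complex.Re (f i) ^+ 2 + complex.Im (f i) ^+ 2)%:E)%E.
Proof. by apply: eq_esum => i _; congr EFin; exact: re_norm_sqr. Qed.

Lemma l2P f : l2 f <-> sqsum (fun i => complex.Re (f i)) /\
                       sqsum (fun i => complex.Im (f i)).
Proof.
have E : l2 f <-> asum (fun i => complex.Re (f i) ^+ 2 + complex.Im (f i) ^+ 2).
  rewrite asum_ge0E; last by move=> i; rewrite addr_ge0 // sqr_ge0.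
  by rewrite /l2 /= l2_sqnormE.
split=> [/E s|[s1 s2]]; last by apply/E; exact: asumD.
by split; apply: asum_le_ge0 s => i; rewrite ger0_norm ?sqr_ge0 // ?lerDl
  ?lerDr sqr_ge0.
Qed.

Lemma l2_normE f : l2 f -> l2_norm f = Num.sqrt (csq f).
Proof.
move=> /l2P[s1 s2]; rewrite /l2_norm; congr Num.sqrt.
have -> : csq f = rsum (fun i => complex.Re (f i) ^+ 2 + complex.Im (f i) ^+ 2).
  by rewrite rsumD //; congr (_ + _); apply: eq_rsum => i; rewrite expr2.
apply: EFin_inj; rewrite rsum_ge0E; [|by move=> i;
  rewrite addr_ge0 // sqr_ge0|exact: asumD].
rewrite -[RHS]fineK; first by rewrite l2_sqnormE.
rewrite ge0_fin_numE; last by apply: esum_ge0 => i _;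
  rewrite lee_fin addr_ge0 // sqr_ge0.
apply: (asum_ge0E _).1; last exact: asumD.
by move=> i; rewrite addr_ge0 // sqr_ge0.
Qed.

Lemma csq_ge0 f : 0 <= csq f.
Proof. by rewrite addr_ge0 // ip_ge0. Qed.

Lemma csq_le0 f : l2 f -> csq f <= 0 -> f = fun=> 0.
Proof.
move=> /l2P[s1 s2] f0; have := ip_ge0 (fun i => complex.Re (f i)).
have := ip_ge0 (fun i => complex.Im (f i)); move: f0; rewrite /csq => f0 i0 r0.
have /(ip_le0 s1) Re0 : ip (fun i => complex.Re (f i)) (fun i =>
  complex.Re (f i)) <= 0 by lra.
have /(ip_le0 s2) Im0 : ip (fun i => complex.Im (f i)) (fun i =>
  complex.Im (f i)) <= 0 by lra.
apply/funext => i; move/(congr1 (fun k => k i)) : Re0;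
  move/(congr1 (fun k => k i)) : Im0 => /=.
by case: (f i) => a b /= -> ->.
Qed.

Lemma l2_lin (a : R[i]) f g : l2 f -> l2 g -> l2 (fun i => a * f i + g i).
Proof.
case: a => a b /l2P[f1 f2] /l2P[g1 g2]; apply/l2P; split.
  have := sqsum_lin (- b) (sqsum_lin a g1 f1) f2; congr sqsum;
    apply/funext => i.
  by case: (f i) (g i) => ? ? [? ?] /=; ring.
have := sqsum_lin b (sqsum_lin a g2 f2) f1; congr sqsum; apply/funext => i.
by case: (f i) (g i) => ? ? [? ?] /=; ring.
Qed.

(** A lower bound gives injectivity, hence linearity of the inverse, and bounds its norm by
    [c^(-1/2)]; surjectivity provides the inverse by choice. *)
Lemma in_resolvent_set (T : (I -> R[i]) -> I -> R[i]) (z : R[i]) (c : R) :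
    0 < c ->
    (forall f, l2 f -> l2 (T f)) ->
    (forall (a : R[i]) f g, l2 f -> l2 g ->
      T (fun i => a * f i + g i) = (fun i => a * T f i + T g i)) ->
    (forall f, l2 f -> c * csq f <= csq (op_sub_scalar T z f)) ->
    (forall g, l2 g -> exists2 f, l2 f & op_sub_scalar T z f = g) ->
  resolvent_set T z.
Proof.
move=> c0 T2 Tlin Tbnd Tsurj.
have Tz2 f : l2 f -> l2 (op_sub_scalar T z f).
  move=> l2f; have := l2_lin (- z) l2f (T2 f l2f); congr l2.
  by apply/funext => i; rewrite /op_sub_scalar mulNr addrC.
have Tzlin a f g : l2 f -> l2 g -> op_sub_scalar T z (fun i => a * f i + g i) =
    (fun i => a * op_sub_scalar T z f i + op_sub_scalar T z g i).
  move=> l2f l2g; apply/funext => i.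
  by rewrite /op_sub_scalar Tlin //; ring.
have inj f g : l2 f -> l2 g -> op_sub_scalar T z f = op_sub_scalar T z g ->
  f = g.
  move=> l2f l2g fg; have l2d := l2_lin (-1) l2f l2g.
  have d0 : op_sub_scalar T z (fun i => -1 * f i + g i) = fun=> 0.
    by rewrite Tzlin // fg; apply/funext => i; rewrite mulN1r addNr.
  have := Tbnd _ l2d; rewrite d0.
  have -> : csq (fun=> 0) = 0 by rewrite /csq /ip /=;
    under eq_rsum do rewrite mulr0; rewrite rsum0 addr0.
  rewrite pmulr_rle0 // => /(csq_le0 l2d) E; apply/funext => i.
  move/(congr1 (fun k => k i)) : E => /eqP.
  by rewrite mulN1r addrC subr_eq0 => /eqP.
(* Only the values on l^2 matter; elsewhere [S] is set to the identity. *)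
pose S g := if pselect (l2 g) is left l2g then s2val (cid2
  (Tsurj g l2g)) else g.
have SP g : l2 g -> l2 (S g) /\ op_sub_scalar T z (S g) = g.
  by rewrite /S; case: pselect => // l2g _; case: cid2 => f.
have TS f : l2 f -> S (op_sub_scalar T z f) = f.
  by move=> l2f; have [l2S E] := SP _ (Tz2 _ l2f); exact: inj.
exists S; split; last first.
  by move=> f l2f; have [l2S E] := SP f l2f; split => //;
    [exact: Tz2|exact: TS].
split=> [f /SP[]//|a f g l2f l2g|].
  have [Sf Ef] := SP f l2f; have [Sg Eg] := SP g l2g.
  have [Sfg Efg] := SP _ (l2_lin a l2f l2g).
  apply: inj => //; first exact: l2_lin.
  by rewrite Efg Tzlin // Ef Eg.
exists (Num.sqrt c^-1) => f l2f; have [Sf Ef] := SP f l2f.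
rewrite !l2_normE // -sqrtrM ?invr_ge0 ?(ltW c0) // ler_wsqrtr //.
by rewrite ler_pdivlMl //; have := Tbnd _ Sf; rewrite Ef.
Qed.

End ComplexL2.

(** * Resolvent set and top of the spectrum on complex l^2 *)

Section SchurSpectrum.
Context (R : realType) (I : choiceType) (w : I -> I -> R) (U Q : I -> R).
Context (E W Qm : R).
Hypothesis w_ge0 : forall i j, 0 <= w i j.
Hypothesis w_sym : forall i j, w i j = w j i.
Hypothesis w_row : forall i, asum (w i).
Hypothesis W_gt0 : 0 < W.
Hypothesis w_rowW : forall i, rsum (w i) <= W.
Hypothesis Q_bound : forall i, `|Q i| <= Qm.
Hypothesis U_gt0 : forall i, 0 < U i.
Hypothesis wU_row : forall i, asum (fun j => w i j * U j).
Hypothesis HU : forall i, rsum (fun j => w i j * U j) = (E - Q i) * U i.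

Definition schr (f : I -> R[i]) : I -> R[i] :=
  fun i => csum (fun j => (w i j)%:C * f j) + (Q i)%:C * f i.

Local Notation H := (schr_op w Q).
Local Notation A := (shift_op w Q).

Lemma schrE f : schr f = fun i =>
  H (fun j => complex.Re (f j)) i +i* H (fun j => complex.Im (f j)) i.
Proof.
apply/funext => i; rewrite /schr /schr_op /adj_op /csum.
have -> : (fun j => complex.Re ((w i j)%:C * f j)) = fun j =>
  w i j * complex.Re (f j).
  by apply/funext => j; case: (f j) => a b /=; ring.
have -> : (fun j => complex.Im ((w i j)%:C * f j)) = fun j =>
  w i j * complex.Im (f j).
  by apply/funext => j; case: (f j) => a b /=; ring.
apply/eqP; rewrite eq_complex; case: (f i) => a b /=.
by apply/andP; split; apply/eqP; ring.
Qed.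

Lemma schr_subE f x y : op_sub_scalar schr (x +i* y) f = fun i =>
  (A x (fun j => complex.Re (f j)) i + y * complex.Im (f i)) +i*
  (A x (fun j => complex.Im (f j)) i + (- y) * complex.Re (f i)).
Proof.
apply/funext => i; rewrite /op_sub_scalar schrE /shift_op.
apply/eqP; rewrite eq_complex; case: (f i) => a b /=.
by apply/andP; split; apply/eqP; ring.
Qed.

Lemma schr_l2 f : l2 f -> l2 (schr f).
Proof.
move=> /l2P[s1 s2]; apply/l2P; rewrite schrE /=.
by split; apply: (schr_sqsum (W := W) (Qm := Qm)).
Qed.

Lemma schr_clin (a : R[i]) f g : l2 f -> l2 g ->
  schr (fun i => a * f i + g i) = (fun i => a * schr f i + schr g i).
Proof.
case: a => a b l2f l2g; have /l2P[f1 f2] := l2f; have /l2P[g1 g2] := l2g.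
rewrite !schrE; apply/funext => i; apply/eqP; rewrite eq_complex /=.
have sl (c d : R) h k := @schr_lin _ _ w Q w_ge0 w_row h k c d.
have -> : (fun j => complex.Re ((a +i* b) * f j + g j)) = fun j =>
    1 * (a * complex.Re (f j) + (- b) * complex.Im (f j)) + 1 * complex.Re
      (g j).
  by apply/funext => j; case: (f j) (g j) => ? ? [? ?] /=; ring.
have -> : (fun j => complex.Im ((a +i* b) * f j + g j)) = fun j =>
    1 * (b * complex.Re (f j) + a * complex.Im (f j)) + 1 * complex.Im (g j).
  by apply/funext => j; case: (f j) (g j) => ? ? [? ?] /=; ring.
have lin2 (c d : R) h k : sqsum h -> sqsum k -> sqsum (fun j : I =>
  c * h j + d * k j).
  by move=> sh sk; apply: sqsum_lin => //; exact: sqsumZ.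
rewrite !sl //; try exact: lin2.
by apply/andP; split; apply/eqP; ring.
Qed.

(** The hypothesis treats all nonreal [z] and the real [z > E] together, so the lemma yields both
    the reality of the spectrum and its upper bound. *)
Lemma schr_resolvent (z : R[i]) :
  (forall x : R, z = x%:C -> E < x) -> resolvent_set schr z.
Proof.
case: z => x y Ez.
have sA := shift_sqsum w_ge0 w_sym w_row W_gt0 w_rowW Q_bound.
have Alin := @shift_lin _ _ w Q w_ge0 w_row.
have Asym := shift_sym w_ge0 w_sym w_row W_gt0 w_rowW Q_bound.
case: (eqVneq y 0) => [y0|y0].
  have Ex : E < x by apply: Ez; rewrite y0.
  have Abnd h : sqsum h -> (x - E) ^+ 2 * ip h h <= ip (A x h) (A x h).
    (* Expanding [|A h + (x - E) h|^2 >= 0] and inserting the form bound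
       [<h, A h> <= - (x - E) |h|^2] gives the lower bound on [|A h|]. *)
    move=> sh; have := ip_ge0 (fun i => A x h i + (x - E) * h i).
    rewrite ip_sqr_lin //; last exact: sA.
    have := shift_form w_ge0 w_sym w_row W_gt0 w_rowW Q_bound U_gt0 wU_row HU x
      sh.
    rewrite (ipC h) => H1 H2.
    have : (x - E) * ip (A x h) h <= (x - E) * ((E - x) * ip h h).
      by rewrite ler_wpM2l // subr_ge0 ltW.
    nra.
  apply: (@in_resolvent_set _ _ _ _ ((x - E) ^+ 2)).
  - by rewrite exprn_gt0 // subr_gt0.
  - exact: schr_l2.
  - exact: schr_clin.
  - move=> f /l2P[f1 f2]; rewrite schr_subE y0 /csq /=.
    have r0 (u v : I -> R) : (fun i => u i + 0 * v i) = u.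
      by apply/funext => i; rewrite mul0r addr0.
    by rewrite oppr0 !r0 mulrDr lerD // Abnd.
  move=> g /l2P[g1 g2].
  have solve := shift_solve_real w_ge0 w_sym w_row W_gt0 w_rowW Q_bound U_gt0
    wU_row HU Ex.
  have [a sa Ea] := solve _ g1; have [b sb Eb] := solve _ g2.
  exists (fun i => a i +i* b i); first by apply/l2P.
  rewrite schr_subE y0 /= Ea Eb; apply/funext => i.
  by case: (g i) => ? ?; rewrite oppr0 !mul0r !addr0.
apply: (@in_resolvent_set _ _ _ _ (y ^+ 2)).
- by rewrite lt_neqAle eq_sym sqrf_eq0 y0 sqr_ge0.
- exact: schr_l2.
- exact: schr_clin.
(* The mixed terms cancel by symmetry of [A], leaving [|A f|^2 + y^2 |f|^2]. *)
- move=> f /l2P[f1 f2]; rewrite schr_subE /csq /=.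
  rewrite (ip_sqr_lin y (sA x _ f1) f2) (ip_sqr_lin (- y) (sA x _ f2) f1).
  have := ip_ge0 (A x (fun i => complex.Re (f i))).
  have := ip_ge0 (A x (fun i => complex.Im (f i))).
  rewrite (Asym _ _ _ f1 f2) (ipC _ (A x _)) sqrrN; lra.
move=> g /l2P[p_sq q_sq].
pose p i := complex.Re (g i); pose q i := complex.Im (g i).
have sAp := sA x _ p_sq.
(* The unknown [a + i b] has to satisfy [A a + y b = p] and [A b - y a = q]. Eliminating [b] leaves
   [A (A a) + y^2 a = A p - y q]. *)
have [a sa Ea] : exists2 a, sqsum a &
    (fun i => A x (A x a) i + y ^+ 2 * a i) = (fun i => A x p i + (- y) * q i).
  by apply: (shift_solve_sqr (W := W) (Qm := Qm)) => //; exact: sqsum_lin.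
have sAa := sA x _ sa.
pose b i := y^-1 * p i + (- y^-1) * A x a i.
have sb : sqsum b by apply: sqsum_lin => //; exact: sqsumZ.
exists (fun i => a i +i* b i); first by apply/l2P.
rewrite schr_subE /=; apply/funext => i.
rewrite /b Alin //; move/(congr1 (fun k => k i)) : Ea => /= Ea.
apply/eqP; rewrite eq_complex /= -/(p i) -/(q i); apply/andP; split; apply/eqP.
  by field.
have -> : A x (A x a) i = A x p i - y * q i - y ^+ 2 * a i by lra.
by field.
Qed.

(* If [H - E] had a bounded inverse, with [(H - E) a = f], the nonnegative form
   of [E - H] at [a + C f] would be negative for an approximate eigenvector [f]
   and a suitable [C]. *)
Lemma schr_spectrum_top :
    (forall e : R, 0 < e -> exists f : I -> R,
      [/\ sqsum f, 0 < ip f f & (E - e) * ip f f <= ip f (H f)]) ->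
  spectrum schr E%:C.
Proof.
move=> approx [S [[S2 _ [c0 Sc]] Sinv]].
(* [C] is a positive bound for the norm of the inverse. With [e = 1 / (2 C)] the error [C^2 e] is
   [C / 2], smaller than the gain [C] obtained below. *)
pose C : R := 1 + `|c0|.
have C0 : 0 < C by rewrite ltr_pwDl.
have [f [sf f0 fE]] := approx (2 * C)^-1 ltac:(by rewrite invr_gt0 mulr_gt0).
pose fc i := (f i)%:C.
have l2f : l2 fc by apply/l2P; split => //; exact: sqsum0.
have [_ _] := Sinv fc l2f; set h := S fc => hE.
have l2h : l2 h by exact: S2.
pose a i := complex.Re (h i).
have sa : sqsum a by have /l2P[] := l2h.
have aE : f = A E a.
  apply/funext => i; move/(congr1 (fun k => complex.Re (k i))) : hE.
  by rewrite (schr_subE h E 0) /= mul0r addr0.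
have csqf : csq fc = ip f f by rewrite /csq /= {2}/ip;
  under [X in _ + X]eq_rsum do rewrite mulr0; rewrite rsum0 addr0.
have aC : ip a a <= C ^+ 2 * ip f f.
  have := Sc _ l2f; rewrite !l2_normE // csqf => Hc.
  have : csq h <= C ^+ 2 * ip f f.
    rewrite -(sqr_sqrtr (csq_ge0 h)) -[ip f f]sqr_sqrtr ?ip_ge0 // -exprMn.
    rewrite ler_pXn2r ?nnegrE ?mulr_ge0 ?sqrtr_ge0 ?(ltW C0) //.
    apply: le_trans Hc _; rewrite ler_wpM2r ?sqrtr_ge0 //.
    by rewrite /C; have := ler_norm c0; lra.
  by apply: le_trans; rewrite /csq lerDl ip_ge0.
have sHa := schr_sqsum w_ge0 w_sym w_row W_gt0 w_rowW Q_bound sa.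
have sHf := schr_sqsum w_ge0 w_sym w_row W_gt0 w_rowW Q_bound sf.
have sAf := shift_sqsum w_ge0 w_sym w_row W_gt0 w_rowW Q_bound E sf.
have sAa := shift_sqsum w_ge0 w_sym w_row W_gt0 w_rowW Q_bound E sa.
have sk : sqsum (fun i => a i + C * f i) by exact: sqsum_lin.
(* Since [A a = f], symmetry makes the form of [A] at [a + C f] equal to
   [<a, f> + 2 C |f|^2 + C^2 <f, A f>]. By [|a| <= C |f|] the first term is at least [- C |f|^2], so
   the total is at least [C |f|^2 / 2 > 0], whereas the form bound makes it nonpositive. *)
have := shift_form w_ge0 w_sym w_row W_gt0 w_rowW Q_bound U_gt0 wU_row HU E sk.
have -> : A E (fun i => a i + C * f i) = fun i => A E a i + C * A E f i.
  have := @shift_lin _ _ w Q w_ge0 w_row E a f 1 C sa sf.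
  under [X in A E X]eq_fun do rewrite mul1r.
  by move=> ->; apply/funext => i; rewrite mul1r.
rewrite subrr mul0r (ip_linr C sAa sAf sk).
rewrite (ip_linl C sa sf sAa) (ip_linl C sa sf sAf) -(shift_sym w_ge0 w_sym
  w_row W_gt0 w_rowW Q_bound E sa sf) -aE.
have -> : ip f (A E f) = ip f (H f) - E * ip f f by rewrite ip_linr // mulNr.
have af : 0 <= ip a f + 2^-1 * (C^-1 * ip a a + C * ip f f).
  have := ip_ge0 (fun i => a i + C * f i); rewrite ip_sqr_lin // => H0.
  rewrite [X in 0 <= X](_ : _ =
      (2 * C)^-1 * (ip a a + 2 * C * ip a f + C ^+ 2 * ip f f)).
    by rewrite mulr_ge0 // invr_ge0 mulr_ge0 // ltW.
  by field; rewrite gt_eqF.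
have aC' : C^-1 * ip a a <= C * ip f f.
  by rewrite ler_pdivrMl // mulrA -expr2.
have : C ^+ 2 * ((E - (2 * C)^-1) * ip f f) <= C ^+ 2 * ip f (H f).
  by rewrite ler_wpM2l // sqr_ge0.
have -> : C ^+ 2 * ((E - (2 * C)^-1) * ip f f) = C ^+ 2 * E * ip f f - C / 2 *
  ip f f.
  by field; rewrite gt_eqF.
have : 0 < C * ip f f by rewrite mulr_gt0.
move: fE; lra.
Qed.

End SchurSpectrum.

(** * Perron eigenvectors *)

Section Perron.
Context (R : realType) (n : nat) (B : 'I_n -> 'I_n -> R).
Hypothesis B_sym : forall i j, B i j = B j i.
Hypothesis B_ge0 : forall i j, i != j -> 0 <= B i j.
Implicit Types u v : 'I_n -> R.

Let Bop v i : R := \sum_j B i j * v j.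

Let sq v : sqsum v := asum_fin _.

Let Bop_lin u v (c : R) :
  Bop (fun i => u i + c * v i) = fun i => Bop u i + c * Bop v i.
Proof.
apply/funext => i; rewrite /Bop mulr_sumr -big_split /=.
by apply: eq_bigr => j _; ring.
Qed.

Let Bop_sym u v : ip (Bop u) v = ip u (Bop v).
Proof.
rewrite /ip !rsum_fin /Bop.
under eq_bigr do rewrite mulr_suml; rewrite exchange_big /=.
apply: eq_bigr => j _; rewrite mulr_sumr; apply: eq_bigr => i _.
by rewrite B_sym; ring.
Qed.

Lemma quadratic_form_max : (0 < n)%N -> exists2 u,
  ip u u = 1 & forall v, ip v (Bop v) <= ip u (Bop u) * ip v v.
Proof.
move=> n0.
pose S := [set v : 'rV[R]_n | ip (v 0) (v 0) = 1]%classic.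
have cont_coord i : continuous (fun v : 'rV[R]_n => v 0 i).
  by move=> v; exact: coord_continuous.
have contM (f g : 'rV[R]_n -> R) : continuous f -> continuous g ->
    continuous (fun x => f x * g x).
  by move=> cf cg x; apply: continuousM; [exact: cf|exact: cg].
have contS (F : 'I_n -> 'rV[R]_n -> R) : (forall i, continuous (F i)) ->
    continuous (fun x => \sum_i F i x).
  move=> cF; apply: (@continuous_big R 'I_n +%R 0 xpredT) => //.
  exact: add_continuous.
have cont_ip : continuous (fun v : 'rV[R]_n => ip (v 0) (v 0)).
  rewrite (_ : (fun x => _) = fun v : 'rV[R]_n => \sum_i v 0 i * v 0 i).
    by apply: contS => i; exact: contM.
  by apply/funext => v; rewrite /ip rsum_fin.
have cont_B : continuous (fun v : 'rV[R]_n => ip (v 0) (Bop (v 0))).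
  rewrite (_ : (fun x => _) = fun v : 'rV[R]_n =>
    \sum_i v 0 i * (\sum_j B i j * v 0 j)).
    apply: (contS) => i; apply: (contM) => //; apply: (contS) => j;
      apply: (contM) => //.
    by move=> v; exact: cst_continuous.
  by apply/funext => v; rewrite /ip rsum_fin.
have cS : closed S.
  rewrite (_ : S = (fun v : 'rV[R]_n => ip (v 0)
    (v 0)) @^-1` [set 1])%classic //.
  by apply: (continuous_closedP _).1 => //; exact: closed_eq.
have kS : compact S.
  (* The Euclidean unit sphere is a closed subset of the cube [[-1, 1]^n], a compact product of
     segments. *)
  apply: (subclosed_compact cS (rV_compact (fun=> @segment_compact R (-1) 1))).
  move=> v /= Sv i; rewrite in_itv /= -ler_norml.
  rewrite -(@ler_pXn2r _ 2) ?nnegrE // real_normK ?num_real // expr1n.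
  by rewrite -Sv sqr_le_ip.
have S0 : (S !=set0)%classic.
  exists (delta_mx 0 (Ordinal n0)); rewrite /S /= /ip rsum_fin (bigD1
    (Ordinal n0)) //=.
  rewrite !mxE !eqxx mulr1 big1 ?addr0 // => i ni.
  by rewrite !mxE (negbTE ni) andbF mulr0.
have [|c cS' cmax] := @EVT_max_rV R n (fun x => ip (x 0) (Bop (x 0))) S S0 kS.
  exact: continuous_subspaceT.
rewrite inE in cS'.
exists (c 0) => // v.
have [v0|v0] := leP (ip v v) 0.
  have -> : v = fun=> 0 by exact: ip_le0.
  have ip0 u : ip (fun=> 0) u = 0 by rewrite /ip rsum_fin big1 // => i _;
    rewrite mul0r.
  by rewrite !ip0 mulr0.
pose a := Num.sqrt (ip v v); have a0 : 0 < a by rewrite sqrtr_gt0.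
have aE : ip v v = a ^+ 2 by rewrite sqr_sqrtr // ltW.
pose t : 'rV[R]_n := \row_i (a^-1 * v i).
have tE : t 0 = fun i => 0 + a^-1 * v i.
  by apply/funext => i; rewrite mxE add0r.
have z0 : ip (fun=> 0) v = 0 by rewrite /ip rsum_fin big1 // => i _;
  rewrite mul0r.
have scal u w : ip (fun i => 0 + a^-1 * u i) (fun i =>
  0 + a^-1 * w i) = a ^- 2 * ip u w.
  by rewrite /ip !rsum_fin mulr_sumr; apply: eq_bigr => i _; field;
    rewrite gt_eqF.
have tS : t \in S.
  by rewrite inE /S /= tE scal aE mulVf // gt_eqF // exprn_gt0.
have := cmax t tS; rewrite tE Bop_lin.
have -> : (fun i => Bop (fun=> 0) i + a^-1 * Bop v i) = fun i =>
  0 + a^-1 * Bop v i.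
  by apply/funext => i; rewrite /Bop big1 // => j _; rewrite mulr0.
by rewrite scal ler_pdivrMl ?exprn_gt0 // -aE mulrC.
Qed.

(** Replacing a maximiser [c] by [|c|] keeps its norm and the diagonal terms and does not decrease
    the off-diagonal ones, so [|c|] is again a maximiser. Its first variation in the direction
    [h = B u - E u] then forces [h = 0]. *)
Lemma perron : (0 < n)%N -> exists (E : R) (u : 'I_n -> R),
  [/\ forall i, 0 <= u i, exists i, 0 < u i &
      forall i, \sum_j B i j * u j = E * u i].
Proof.
move=> n0; have [c c1 cmax] := quadratic_form_max n0.
pose E := ip c (Bop c); pose u (i : 'I_n) : R := `|c i|.
have u1 : ip u u = 1.
  by rewrite -c1 /ip !rsum_fin; apply: eq_bigr => i _;
    rewrite -normrM ger0_norm // -expr2 sqr_ge0.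
have uE : E <= ip u (Bop u).
  rewrite /E /ip !rsum_fin; apply: ler_sum => i _; rewrite /Bop !mulr_sumr.
  apply: ler_sum => j _; rewrite !(mulrCA _ (B i j)) /u -normrM.
  case: (eqVneq i j) => [->|ij]; first by rewrite ger0_norm // -expr2 sqr_ge0.
  by rewrite ler_wpM2l ?B_ge0 // ler_norm.
exists E, u; split=> [i||i]; first exact: normr_ge0.
  apply: contrapT => H; have : ip u u = 0.
    rewrite /ip rsum_fin big1 // => i _; suff -> : u i = 0 by rewrite mul0r.
    apply/eqP; rewrite normr_eq0; apply: contrapT => ci; apply: H; exists i.
    by rewrite normr_gt0; apply/negP.
  by rewrite u1 => /eqP; rewrite oner_eq0.
pose h i := Bop u i + (- E) * u i.
have hh : ip h (Bop u) - E * ip h u = ip h h.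
  by rewrite {3 4}/h ip_linr // ; ring.
(* Maximality at [u + t h]: the linear coefficient in [t] is twice the squared norm of [h]. *)
have ineq t : 2 * t * ip h h + t ^+ 2 * (ip h (Bop h) - E * ip h h) <= 0.
  have := cmax (fun i => u i + t * h i).
  rewrite -/E Bop_lin (ip_sqr_lin t (sq u) (sq h)) (ip_linl t (sq u) (sq h)
    (sq _)).
  rewrite (ip_linr t (sq _) (sq _) (sq u)) (ip_linr t (sq _) (sq _) (sq h)).
  rewrite u1 -(Bop_sym u h) (ipC (Bop u)) (ipC u h) -hh.
  move: uE; lra.
set x := ip h h in hh ineq; set K := _ - _ in ineq.
have x0 : 0 <= x by exact: ip_ge0.
have K0 : 0 < 1 + `|K| by rewrite ltr_pwDl.
have x_le0 : x <= 0.
  rewrite leNgt; apply/negP => xp.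
  (* This [t] is small enough for the linear term to dominate the quadratic one, whatever the sign
     of [K]. *)
  have := ineq (x / (1 + `|K|)).
  rewrite (_ : _ + _ = x ^+ 2 * (2 * (1 + `|K|) + K) / (1 + `|K|) ^+ 2);
    last first.
    by field; rewrite gt_eqF.
  apply/negP; rewrite -ltNge divr_gt0 ?exprn_gt0 // mulr_gt0 ?exprn_gt0 //.
  by have := ler_norm (- K); rewrite normrN; lra.
have /(congr1 (fun k => k i)) /eqP := ip_le0 (sq h) x_le0.
by rewrite /h mulNr subr_eq0 => /eqP.
Qed.

End Perron.

(** * Finite approximation and maxima of summable families *)

Section FiniteApproximation.
Context (R : realType) (I : choiceType) (f : I -> R).
Hypothesis f_ge0 : forall i, 0 <= f i.
Hypothesis f_asum : asum f.

Lemma rsum_fin_approx (e : R) : 0 < e ->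
  exists2 s : seq I, uniq s & rsum f - e < \sum_(i <- s) f i.
Proof.
move=> e0; apply: contrapT => H.
suff : rsum f <= rsum f - e by rewrite lerBrDr gerDl leNgt e0.
apply: rsum_le_fin => // s us; rewrite leNgt; apply/negP => fs.
by apply: H; exists s.
Qed.

(** A finite [s] carries all but less than [f i0] of the total, so no value outside [s] exceeds
    [f i0], and the maximum is found on the finite list [i0 :: s]. *)
Lemma asum_argmax i0 : 0 < f i0 -> exists i, 0 < f i /\ forall j, f j <= f i.
Proof.
move=> fi0; have [s us fs] := rsum_fin_approx fi0.
have small j : j \notin s -> f j <= f i0.
  move=> js; have := @fin_le_rsum _ _ f (j :: s) f_ge0 f_asum.
  by rewrite /= js us big_cons => /(_ isT); lra.
have seq_max (t : seq I) i1 :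
    exists2 i, i \in i1 :: t & forall j, j \in i1 :: t -> f j <= f i.
  elim: t i1 => [|a t IH] i1.
    by exists i1; rewrite ?mem_head // => j /[!inE] /eqP ->.
  have [i it imax] := IH a.
  case: (leP (f i1) (f i)) => fi.
    exists i; first by rewrite inE it orbT.
    by move=> j; rewrite inE => /predU1P[-> //|/imax].
  exists i1; first exact: mem_head.
  by move=> j; rewrite inE => /predU1P[-> //|/imax /le_trans]; apply;
    exact: ltW.
have [i _ imax] := seq_max s i0.
have fi0i : f i0 <= f i by apply: imax; exact: mem_head.
exists i; split=> [|j]; first exact: lt_le_trans fi0i.
have [js|/small/le_trans] := boolP (j \in s); last exact.
by apply: imax; rewrite inE js orbT.
Qed.

End FiniteApproximation.

(** * Exponential decay on the lattice *)

Section LatticeDecay.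
Context (R : realType) (q : R).
Hypothesis q_gt0 : 0 < q.
Hypothesis q_lt1 : q < 1.

Definition lat_norm d (k : 'rV[int]_d) : nat := (\sum_j `|k 0%R j|)%N.

Lemma lat_normD d (k l : 'rV[int]_d) :
  (lat_norm (k + l)%R <= lat_norm k + lat_norm l)%N.
Proof.
rewrite /lat_norm -big_split /=; apply: leq_sum => j _.
by rewrite mxE -lez_nat PoszD !abszE ler_normD.
Qed.

Lemma asum_int_decay : asum (fun a : int => q ^+ `|a|%N).
Proof.
pose e (p : bool * nat) : int := if p.1 then Posz p.2 else Negz p.2.
have be : bijective e.
  exists (fun a => match a with Posz n => (true, n) | Negz n => (false, n) end).
    by case=> -[].
  by case.
apply: (asum_reindex _ be).2.
have [sq _] := geometric_asum (ltW q_gt0) q_lt1.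
apply: (asum_pair_ge0 (F := fun b n => q ^+ `|e (b, n)|%N)) => [b n|[]|].
- by rewrite exprn_ge0 // ltW.
- exact: sq.
(* [Negz n] stands for [- (n + 1)], hence one more factor [q] on the negative half. *)
- have := asumZ q sq; congr asum; apply/funext => n.
  by rewrite -exprS.
- exact: asum_fin.
Qed.

(** [lat_norm] is the l^1 norm, so the family is a product over the coordinates and induction on [d]
    applies. *)
Lemma asum_lattice_decay d : asum (fun k : 'rV[int]_d => q ^+ lat_norm k).
Proof.
elim: d => [|d IHd].
  apply: (asum_fin_le (C := 1)) => -[|k [|l s]] /=.
  - by rewrite big_nil.
  - by rewrite big_seq1 /lat_norm big_ord0 expr0 normr1.
  - by rewrite inE (_ : k = l) ?eqxx //; apply/rowP => -[].
pose e (p : int * 'rV[int]_d) : 'rV[int]_(1 + d) := row_mx (const_mx p.1) p.2.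
have be : bijective e.
  exists (fun k => (lsubmx k 0 0, rsubmx k)).
    by case=> a k; rewrite /e row_mxKl row_mxKr mxE.
  move=> k; rewrite /e -[RHS]hsubmxK; congr row_mx.
  by apply/matrixP => i j; rewrite mxE !ord1.
apply: (asum_reindex _ be).2.
have E a k : q ^+ lat_norm (e (a, k)) = q ^+ `|a|%N * q ^+ lat_norm k.
  rewrite -exprD /lat_norm big_split_ord /= big_ord1; congr (q ^+ (_ + _)).
    by rewrite row_mxEl mxE.
  by apply: eq_bigr => j _; rewrite row_mxEr.
have qX n : 0 <= q ^+ n by rewrite exprn_ge0 // ltW.
apply: (asum_pair_ge0 (F := fun a k => q ^+ lat_norm (e (a, k)))) => // [a|].
  by under [X in asum X]funext do rewrite E; exact: asumZ.
have := asumZ (rsum (fun k : 'rV[int]_d => q ^+ lat_norm k)) asum_int_decay.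
congr asum; apply/funext => a; under [RHS]eq_rsum do rewrite E.
by rewrite rsumZ // mulrC.
Qed.

Lemma bernoulli_le n : 1 - n%:R * (1 - q) <= q ^+ n.
Proof.
elim: n => [|n IHn]; first by rewrite mul0r subr0 expr0.
have : q * (1 - n%:R * (1 - q)) <= q ^+ n.+1 by rewrite exprS ler_wpM2l // ltW.
apply: le_trans; rewrite -natr1.
have : 0 <= n%:R * (1 - q) ^+ 2 by rewrite mulr_ge0 // sqr_ge0.
nra.
Qed.

End LatticeDecay.

(** * Sums of complex families *)

Section ComplexSums.
Context (R : realType).

Lemma csumZ (I : choiceType) (a : R[i]) (f : I -> R[i]) :
    asum (fun i => complex.Re (f i)) -> asum (fun i => complex.Im (f i)) ->
  csum (fun i => a * f i) = a * csum f.
Proof.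
case: a => a b sr si; rewrite /csum; apply/eqP; rewrite eq_complex /=.
have -> : (fun i => complex.Re ((a +i* b) * f i)) =
          fun i => a * complex.Re (f i) - b * complex.Im (f i).
  by apply/funext => i; case: (f i).
have -> : (fun i => complex.Im ((a +i* b) * f i)) =
          fun i => a * complex.Im (f i) + b * complex.Re (f i).
  by apply/funext => i; case: (f i).
rewrite rsumB ?rsumD ?rsumZ //; try exact: asumZ.
by rewrite !eqxx.
Qed.

Lemma csum_reindex (I J : choiceType) (e : I -> J) (f : J -> R[i]) :
  bijective e -> csum f = csum (f \o e).
Proof. by move=> be; rewrite /csum !(rsum_reindex _ be). Qed.

Lemma csum_pair_fin (J : finType) (K : choiceType) (f : J * K -> R[i]) :
    asum (fun p => complex.Re (f p)) -> asum (fun p => complex.Im (f p)) ->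
  csum f = \sum_j csum (fun k => f (j, k)).
Proof.
move=> sr si; rewrite /csum.
have surj (h : J * K -> R) : asum h -> rsum h = \sum_j rsum (fun k => h (j, k)).
  move=> sh; have E : h = fun p => h (p.1, p.2) by apply/funext => -[].
  have sh' : asum (fun p : J * K => h (p.1, p.2)) by rewrite -E.
  have [_ r] := rsum_pair (F := fun j k => h (j, k)) sh'.
  by rewrite E -r rsum_fin.
rewrite !surj //; apply/eqP; rewrite eq_complex /= !raddf_sum /=.
by rewrite !eqxx.
Qed.

Lemma cisD (x y : R) : cis (x + y) = cis x * cis y.
Proof.
rewrite /cis cosD sinD; apply/eqP; rewrite eq_complex /=.
by apply/andP; split; apply/eqP; ring.
Qed.

End ComplexSums.

(** * Periodic graphs *)

Section Coordinates.
Context (R : realType) (d nu : nat) (X : periodic_vertices R d nu).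
Implicit Types (v : vertex X) (k l : 'rV[int]_d).

Definition cell_translate (p : 'I_nu * 'rV[int]_d) : vertex X :=
  translate (cell_vertex X p.1) p.2.

Lemma translateD v k l : translate (translate v k) l = translate v (k + l).
Proof. by apply: val_inj; rewrite /= lattice_vecD addrA. Qed.

Lemma translate0 v : translate v 0 = v.
Proof. by apply: val_inj; rewrite /= lattice_vec0 addr0. Qed.

Lemma translate_bij l : bijective (fun v => translate v l).
Proof.
exists (fun v => translate v (- l)) => v.
  by rewrite translateD subrr translate0.
by rewrite translateD addNr translate0.
Qed.

Lemma cell_translate_unique v : exists! p, cell_translate p = v.
Proof.
have /set_mem/vset_repr [p [vE pu]] := valP v; exists p; split=> [|p' p'E].
  by apply: val_inj; rewrite vE.
by apply: pu; rewrite -p'E.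
Qed.

(** The inverse of [cell_translate]: it identifies the vertex set with cell times lattice, which
    turns sums over vertices into sums over the cell and over [Z^d]. *)
Definition coord v : 'I_nu * 'rV[int]_d := sval (cid (cell_translate_unique v)).

Lemma coordK : cancel coord cell_translate.
Proof. by move=> v; rewrite /coord; case: cid => p []. Qed.

Lemma cell_translateK : cancel cell_translate coord.
Proof.
move=> p; rewrite /coord; case: cid => p' [_ pu] /=; exact: pu.
Qed.

Lemma cell_translate_bij : bijective cell_translate.
Proof. by exists coord; [exact: cell_translateK|exact: coordK]. Qed.

Lemma coord_translate v l :
  coord (translate v l) = ((coord v).1, (coord v).2 + l).
Proof.
rewrite -[RHS]cell_translateK; congr coord.
by rewrite -[in LHS](coordK v) /cell_translate translateD.
Qed.

Lemma coord_cell i : coord (cell_vertex X i) = (i, 0).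
Proof.
by rewrite -[RHS]cell_translateK /cell_translate translate0.
Qed.

Lemma translate_coord v : translate (cell_vertex X (coord v).1) (coord v).2 = v.
Proof. exact: coordK. Qed.

End Coordinates.

(** * The Floquet matrix at zero and the periodic ground state *)

Section PeriodicGraph.
Context (R : realType) (d nu : nat) (G : periodic_graph R d nu).
Hypothesis d_gt0 : (0 < d)%N.
Hypothesis nu_gt0 : (0 < nu)%N.
Hypothesis G_connected : graph_connected G.

Local Notation V := (vertex (vertices G)).
Local Notation cellv := (cell_vertex (vertices G)).
Local Notation w := (@weight R d nu G).
Local Notation Q := (@potential R d nu G).
Implicit Types (v : V).

Lemma weight_asum v : asum (w v).
Proof. by apply/asum_ge0E; [exact: weight_ge0|exact: weight_summable]. Qed.

(** Periodicity moves a translation from the weight to the function, which reduces a statement at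
    any vertex to one at a vertex of the cell. *)
Lemma rsum_weight_translate (F : V -> R) v l :
  rsum (fun v' => w (translate v l) v' * F v') =
  rsum (fun v' => w v v' * F (translate v' l)).
Proof.
rewrite (rsum_reindex _ (translate_bij _ l)).
by apply: eq_rsum => v' /=; rewrite weight_periodic.
Qed.

Lemma csum_weight_translate (F : V -> R[i]) v l :
  csum (fun v' => (w (translate v l) v')%:C * F v') =
  csum (fun v' => (w v v')%:C * F (translate v' l)).
Proof.
rewrite (csum_reindex _ (translate_bij _ l)); congr csum.
by apply/funext => v' /=; rewrite weight_periodic.
Qed.

Lemma weight_row_bound : exists2 W : R, 0 < W & forall v, rsum (w v) <= W.
Proof.
pose r i := rsum (w (cellv i)).
have r0 i : 0 <= r i by apply: rsum_ge0 => v; exact: weight_ge0.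
exists (1 + \sum_i r i); first by rewrite ltr_pwDl // sumr_ge0.
move=> v; have -> : rsum (w v) = r (coord v).1.
  have := rsum_weight_translate (fun=> 1) (cellv (coord v).1) (coord v).2.
  by rewrite translate_coord; under eq_rsum do rewrite mulr1;
    under [in RHS]eq_rsum do rewrite mulr1.
by rewrite (bigD1 (coord v).1) //= addrCA lerDl addr_ge0 // sumr_ge0.
Qed.

Lemma potential_cell v : Q v = Q (cellv (coord v).1).
Proof. by rewrite -{1}(translate_coord v) potential_periodic. Qed.

Lemma potential_bound v : `|Q v| <= \sum_i `|Q (cellv i)|.
Proof.
by rewrite potential_cell (bigD1 (coord v).1) //= lerDl sumr_ge0.
Qed.

Lemma cell_weight_asum i j : asum (cell_weight G i j).
Proof.
have := (asum_reindex _ (cell_translate_bij (vertices G))).1 (weight_asum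
  (cellv i)).
move=> s; apply: (asum_row (F := fun j k => cell_weight G i j k) j).
by apply: asum_le s => p; rewrite /cell_translate.
Qed.

Lemma cell_weight_sym i j k : cell_weight G i j k = cell_weight G j i (- k).
Proof.
rewrite /cell_weight weight_sym -(weight_periodic _ _ (- k)) translateD subrr.
by rewrite translate0.
Qed.

Lemma rsum_cell (F : V -> R) : asum F ->
  rsum F = \sum_j rsum (fun k => F (translate (cellv j) k)).
Proof.
move=> sF; have be := cell_translate_bij (vertices G).
have sF' := (asum_reindex _ be).1 sF.
rewrite (rsum_reindex _ be).
have [_ <-] := rsum_pair (F := fun j k => F (translate (cellv j) k)) sF'.
by rewrite rsum_fin.
Qed.

(** [H(0)] as a real matrix, all phases being 1; [floquet_matrix0] identifies the two. *)
Definition floquet0 i j : R :=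
  rsum (cell_weight G i j) + cell_potential G i *+ (i == j).

Lemma floquet0_sym i j : floquet0 i j = floquet0 j i.
Proof.
rewrite /floquet0 eq_sym; congr (_ + _); last by case: eqVneq => // ->.
rewrite (rsum_reindex (e := (@GRing.opp 'rV[int]_d))) /=; last first.
  by exists (@GRing.opp _) => k; rewrite opprK.
by apply: eq_rsum => k; rewrite /= cell_weight_sym opprK.
Qed.

Lemma floquet0_ge0 i j : i != j -> 0 <= floquet0 i j.
Proof.
move=> /negbTE ij; rewrite /floquet0 ij mulr0n addr0.
by apply: rsum_ge0 => k; exact: weight_ge0.
Qed.

Lemma weight_mul_asum v (F : V -> R) (C : R) : (forall v', `|F v'| <= C) ->
  asum (fun v' => w v v' * F v').
Proof.
move=> FC; apply: asum_le_ge0 (asumZ C (weight_asum v)) => v'.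
by rewrite normrM ger0_norm ?weight_ge0 // mulrC ler_wpM2r ?weight_ge0.
Qed.

Lemma periodic_bound (u : 'I_nu -> R) v : `|u (coord v).1| <= \sum_i `|u i|.
Proof. by rewrite (bigD1 (coord v).1) //= lerDl sumr_ge0. Qed.

Lemma floquet0_lift (u : 'I_nu -> R) (E : R) :
    (forall i, \sum_j floquet0 i j * u j = E * u i) -> forall v,
  rsum (fun v' => w v v' * u (coord v').1) = (E - Q v) * u (coord v).1.
Proof.
move=> uE v; rewrite -{1}(translate_coord v) rsum_weight_translate.
under eq_rsum do rewrite coord_translate /=.
rewrite potential_cell; move: (coord v).1 => i.
rewrite rsum_cell; last exact: weight_mul_asum (periodic_bound u).
have -> : (E - Q (cellv i)) * u i = \sum_j rsum (cell_weight G i j) * u j.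
  rewrite mulrBl -uE /floquet0.
  have -> : Q (cellv i) * u i = \sum_j (cell_potential G i *+ (i == j)) * u j.
    rewrite (bigD1 i) //= eqxx mulr1n big1 ?addr0 // => j.
    by rewrite eq_sym => /negbTE ->; rewrite mulr0n mul0r.
  by rewrite -sumrB; apply: eq_bigr => j _; rewrite mulrDl addrK.
apply: eq_bigr => j _.
rewrite [RHS]mulrC -rsumZ; last exact: cell_weight_asum.
by apply: eq_rsum => k; rewrite coord_translate coord_cell /= mulrC.
Qed.

(** At a zero of [U] the nonnegative terms [w v v' * U v'] sum to zero, so [U] vanishes at every
    neighbour. Along a path, a zero would reach a vertex where [U] is positive. *)
Lemma periodic_ground_state : exists (E : R) (u : 'I_nu -> R),
  [/\ forall i, 0 < u i, forall i, \sum_j floquet0 i j * u j = E * u i &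
   forall v, rsum (fun v' => w v v' * u (coord v').1) = (E - Q v) * u
     (coord v).1].
Proof.
have [E [u [u0 [i0 ui0] uE]]] := perron floquet0_sym floquet0_ge0 nu_gt0.
have lift := floquet0_lift uE.
exists E, u; split=> // i; rewrite lt_neqAle u0 andbT eq_sym; apply/eqP => ui.
have [p [pw pl]] := G_connected (cellv i) (cellv i0).
have ui' : u (coord (cellv i)).1 = 0 by rewrite coord_cell.
have : u (coord (last (cellv i) p)).1 = 0.
  elim: p (cellv i) ui' pw {pl} => //= v' p IHp v uv /andP[wv /IHp]; apply.
  have s := weight_mul_asum v (periodic_bound u).
  have t0 v'' : 0 <= w v v'' * u (coord v'').1 by rewrite mulr_ge0 ?weight_ge0.
  have := rsum_ge0_eq0 t0 s; rewrite lift uv mulr0 => /(_ (lexx _) v') /eqP.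
  by rewrite mulf_eq0 gt_eqF //= => /eqP.
by rewrite pl coord_cell /= => ui0'; rewrite ui0' ltxx in ui0.
Qed.

(** * Consequences of a positive periodic ground state *)

Section GroundState.
Context (E : R) (u : 'I_nu -> R).
Hypothesis u_gt0 : forall i, 0 < u i.
Hypothesis uE : forall v,
  rsum (fun v' => w v v' * u (coord v').1) = (E - Q v) * u (coord v).1.

Let U v : R := u (coord v).1.
Let U_gt0 v : 0 < U v. Proof. exact: u_gt0. Qed.
Let wU_asum v : asum (fun v' => w v v' * U v').
Proof. exact: weight_mul_asum (periodic_bound u). Qed.

Lemma cell_arg_max (g : 'I_nu -> R) : exists i, forall j, g j <= g i.
Proof.
pose i0 := Ordinal nu_gt0.
exists [arg max_(i > i0) g i]%O; case: arg_maxP => // i _ imax j; exact: imax.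
Qed.

Lemma U_lower : exists2 c : R, 0 < c & forall v, c <= U v.
Proof.
have [i imin] := cell_arg_max (fun i => - u i).
by exists (u i) => // v; rewrite -lerN2 imin.
Qed.

(** The maximum principle is iterated along a path from [v0]. Proportionality to [U] is carried from
    vertex to vertex in cross-multiplied form. *)
Lemma ground_state_rigid (f : V -> R[i]) (z : R[i]) (M : R) v0 :
    E <= complex.Re z -> 0 < M ->
    (forall v, complex.Re (f v) ^+ 2 + complex.Im (f v) ^+ 2 <=
      (M * U v) ^+ 2) ->
    complex.Re (f v0) ^+ 2 + complex.Im (f v0) ^+ 2 = (M * U v0) ^+ 2 ->
    (forall v, schroedinger f v = z * f v) ->
  forall v, f v * (U v0)%:C = f v0 * (U v)%:C.
Proof.
move=> Ez M0 fM fv0 fz v.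
have UC v' : (U v')%:C != 0 :> R[i] by rewrite eq_complex /= gt_eqF.
have [p [pw <-]] := G_connected v0 v.
suff step q v1 : path (fun x y => 0 < w x y) v1 q ->
    f v1 * (U v0)%:C = f v0 * (U v1)%:C ->
    f (last v1 q) * (U v0)%:C = f v0 * (U (last v1 q))%:C by exact: step.
elim: q v1 => //= v' q IHq v1 /andP[w1 qw] fv1.
apply: IHq qw _.
(* Proportionality up to [v1] transports the equality [|f| = M * U] from [v0] to [v1], as the next
   edge requires. *)
have fv1M : complex.Re (f v1) ^+ 2 + complex.Im (f v1) ^+ 2 = (M * U v1) ^+ 2.
  apply: (mulIf (_ : U v0 ^+ 2 != 0)); first by rewrite sqrf_eq0 gt_eqF.
  rewrite [RHS](_ : _ = (M * U v0) ^+ 2 * U v1 ^+ 2); last by ring.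
  rewrite -fv0; move: fv1; case: (f v1) (f v0) => a b [a0 b0] /=.
  move=> /eqP; rewrite eq_complex /= => /andP[/eqP A /eqP B].
  rewrite (_ : (a ^+ 2 + _) * _ =
    (a * U v0 - b * 0) ^+ 2 + (a * 0 + b * U v0) ^+ 2); last by ring.
  by rewrite A B; ring.
have := max_principle (@weight_ge0 _ _ _ G) U_gt0 wU_asum uE Ez M0 fM fv1M
  (fz v1) w1.
move=> H; apply: (mulIf (UC v1)).
by rewrite mulrAC H mulrAC fv1 mulrAC.
Qed.

Lemma ground_state_not_eigenvalue : ~ is_eigenvalue
  (@schroedinger R d nu G) E%:C.
Proof.
case=> f [l2f [v1 fv1] fE]; have /l2P[sr si] := l2f.
pose h v := complex.Re (f v) ^+ 2 + complex.Im (f v) ^+ 2.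
have h0 v : 0 <= h v by rewrite addr_ge0 // sqr_ge0.
have sh : asum h by exact: asumD.
pose g v := h v / U v ^+ 2.
have U20 v : 0 < U v ^+ 2 by rewrite exprn_gt0.
have g0 v : 0 <= g v by rewrite divr_ge0 // ltW.
have [c c0 cU] := U_lower.
(* The lower bound [c] on [U] makes [|f|^2 / U^2] summable, so that it attains its maximum. *)
have sg : asum g.
  apply: asum_le_ge0 (asumZ (c ^- 2) sh) => v.
  rewrite ger0_norm // /g mulrC ler_wpM2r // lef_pV2 ?posrE ?exprn_gt0 //.
  by rewrite ler_pXn2r // ?nnegrE ltW.
have gv1 : 0 < g v1.
  rewrite divr_gt0 // lt_neqAle h0 andbT eq_sym /h paddr_eq0 ?sqr_ge0 //
    !sqrf_eq0.
  by move: fv1; case: (f v1) => a b; rewrite eq_complex.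
have [v0 [gv0 gmax]] := asum_argmax g0 sg gv1.
pose M := Num.sqrt (g v0); have M0 : 0 < M by rewrite sqrtr_gt0.
have ME v : (M * U v) ^+ 2 = g v0 * U v ^+ 2 by rewrite exprMn sqr_sqrtr // ltW.
have hE v : h v = g v * U v ^+ 2 by rewrite divfK // gt_eqF.
have rigid := @ground_state_rigid f E%:C M v0 (lexx _) M0.
have {}rigid v : f v * (U v0)%:C = f v0 * (U v)%:C.
  apply: rigid => [v'||v'].
  - by rewrite ME -/(h v') hE ler_wpM2r // ltW.
  - by rewrite ME -/(h v0) hE.
  - by rewrite fE.
have fT k : f (translate v0 k) = f v0.
  have UC : (U v0)%:C != 0 :> R[i] by rewrite eq_complex /= gt_eqF.
  by apply: (mulIf UC); rewrite rigid /U coord_translate.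
(* Since [0 < d], these translates of [v0] are pairwise distinct; [f] takes the same nonzero value
   at all of them, which contradicts summability. *)
pose pt (n : nat) : V := translate v0 (const_mx (Posz n)).
have pt_inj : injective pt.
  move=> m n /(congr1 (fun v => (coord v).2 0 (Ordinal d_gt0))).
  by rewrite !coord_translate /= !mxE => /addrI [].
have hv0 : 0 < h v0 by rewrite hE mulr_gt0.
have bnd n : n%:R * h v0 <= rsum h.
  have := fin_le_rsum (s := map pt (iota 0 n)) h0 sh.
  rewrite map_inj_uniq // iota_uniq big_map => /(_ isT); apply: le_trans.
  under eq_bigr do rewrite /h fT -/(h v0).
  by rewrite big_const_seq count_predT size_iota iter_addr_0 mulr_natl.
have := bnd (Num.Def.archi_bound (rsum h / h v0)).
rewrite -ler_pdivlMr // leNgt => /negP; apply.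
by apply: archi_boundP; rewrite divr_ge0 // ?rsum_ge0 // ltW.
Qed.

(** As [q] tends to 1 the damped sum tends to the full one, [(E - Q) * u i]. The estimate holds for
    all [q] beyond a threshold, so that the thresholds of the finitely many cell vertices can be
    combined. *)
Lemma ground_state_cutoff (e : R) i : 0 < e -> exists q0 : R,
  [/\ 0 < q0, q0 < 1 & forall q, q0 <= q -> q < 1 ->
   (E - Q (cellv i) - e) * u i <=
   rsum (fun v => w (cellv i) v * (U v * q ^+ lat_norm (coord v).2))].
Proof.
move=> e0; pose L v := lat_norm (coord v).2.
pose F v := w (cellv i) v * U v.
have F0 v : 0 <= F v by rewrite mulr_ge0 ?weight_ge0 // ltW.
pose T := rsum F; have T0 : 0 <= T by exact: rsum_ge0.
pose de := e * u i; have de0 : 0 < de by rewrite mulr_gt0.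
have de20 : 0 < de / 2 by rewrite divr_gt0.
have [s us Fs] := rsum_fin_approx F0 de20.
(* [m] bounds the lattice norm on [s], so [q^L >= 1 - m * ep] there by Bernoulli. The choice of [ep]
   keeps the loss [m * ep * T] below [de / 2]; the other half of [de] pays for the terms outside
   [s]. *)
pose m : R := (\sum_(v <- s) L v)%:R; have m0 : 0 <= m by exact: ler0n.
have k0 : 0 < 1 + de + m * T by rewrite ltr_wpDr ?mulr_ge0 // ltr_pwDl // ltW.
pose ep := de / 2 / (1 + de + m * T).
have ep0 : 0 < ep by rewrite divr_gt0.
have ep1 : ep < 1 by rewrite ltr_pdivrMr // mul1r; have := mulr_ge0 m0 T0; lra.
have epT : ep * (m * T) <= de / 2.
  by rewrite /ep mulrAC ler_pdivrMr // ler_wpM2l ?(ltW de20) //; lra.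
exists (1 - ep); split=> [||q q1 q2]; rewrite ?subr_gt0 ?gtrBl //.
have q0 : 0 < q by apply: lt_le_trans q1; rewrite subr_gt0.
have Fq0 v : 0 <= w (cellv i) v * (U v * q ^+ L v).
  by rewrite mulr_ge0 ?weight_ge0 // mulr_ge0 ?exprn_ge0 ?(ltW q0) // ltW.
have sFq : asum (fun v => w (cellv i) v * (U v * q ^+ L v)).
  apply: asum_le_ge0 (wU_asum (cellv i)) => v.
  rewrite ger0_norm // ler_wpM2l ?weight_ge0 // ler_piMr ?(ltW (U_gt0 v)) //.
  by rewrite exprn_ile1 // ltW.
apply: le_trans (fin_le_rsum Fq0 sFq us).
have : (1 - m * ep) * \sum_(v <- s) F v <= \sum_(v <- s) w (cellv i) v *
  (U v * q ^+ L v).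
  rewrite mulr_sumr big_seq [leRHS]big_seq; apply: ler_sum => v vs.
  rewrite mulrA -/(F v) mulrC ler_wpM2l //; apply: le_trans (bernoulli_le q0 _).
  have Lm : (L v)%:R <= m by rewrite /m ler_nat (big_rem v vs) /= leq_addr.
  rewrite lerD2l lerN2 ler_pM ?ler0n ?subr_ge0 ?(ltW q2) //; lra.
have : \sum_(v <- s) F v <= T by exact: fin_le_rsum F0 (wU_asum _) us.
have -> : (E - Q (cellv i) - e) * u i = T - de.
  by rewrite /T /F uE coord_cell /de; ring.
move=> sT; apply: le_trans.
have : m * ep * \sum_(v <- s) F v <= m * ep * T.
  by rewrite ler_wpM2l // mulr_ge0 // ltW.
have -> : m * ep * T = ep * (m * T) by ring.
rewrite mulrBl mul1r; move: Fs; rewrite -/T; lra.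
Qed.

(** Since [q^|k + l| >= q^|k| * q^|l|], the estimate in the cell, multiplied by [q^|l|], carries
    over to the translates by [l]. Thus [H f >= (E - e) f] holds at every vertex, and pairing with
    [f > 0] gives the form inequality. *)
Lemma ground_state_approx (e : R) : 0 < e -> exists f : V -> R,
  [/\ sqsum f, 0 < ip f f & (E - e) * ip f f <= ip f (schr_op w Q f)].
Proof.
move=> e0.
have [qf qfP] := choice (fun i => ground_state_cutoff i e0).
(* The largest threshold works for all cell vertices at once. *)
have [i0 i0max] := cell_arg_max qf; pose q := qf i0.
have [q0 q1 _] := qfP i0; rewrite -/q in q0 q1.
pose L v := lat_norm (coord v).2; pose f v := U v * q ^+ L v.
have f0 v : 0 < f v by rewrite mulr_gt0 // exprn_gt0.
have f_le v : f v <= \sum_i `|u i|.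
  apply: le_trans (_ : U v <= _).
    by rewrite ler_piMr ?(ltW (U_gt0 v)) // exprn_ile1 // ltW.
  exact: le_trans (ler_norm _) (periodic_bound _ _).
have sL : asum (fun v => q ^+ L v).
  apply: (asum_reindex _ (cell_translate_bij (vertices G))).2.
  apply: (asum_pair_ge0 (F := fun i k => q ^+ L (cell_translate (vertices G)
    (i, k)))).
  - by move=> i k; rewrite exprn_ge0 // ltW.
  - move=> i; have := asum_lattice_decay q0 q1 d; congr asum; apply/funext => k.
    by rewrite /L cell_translateK.
  - exact: asum_fin.
pose C := \sum_i `|u i|; have C0 : 0 <= C by exact: sumr_ge0.
have sf : sqsum f.
  apply: asum_le_ge0 (asumZ (C ^+ 2) sL) => v.
  rewrite ger0_norm ?sqr_ge0 // expr2 -/(f v) {2}/f mulrA ler_wpM2r ?exprn_ge0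
    ?(ltW q0) //.
  rewrite expr2 ler_pM ?(ltW (f0 v)) ?(ltW (U_gt0 v)) ?f_le //.
  exact: le_trans (ler_norm _) (periodic_bound _ _).
have sfw v : asum (fun v' => w v v' * f v').
  by apply: (@weight_mul_asum _ _ C) => v'; rewrite ger0_norm // ltW.
have Hf v : (E - e) * f v <= schr_op w Q f v.
  pose i := (coord v).1; pose l := (coord v).2.
  have [_ _ /(_ q (i0max i) q1) cut] := qfP i.
  have -> : schr_op w Q f v = rsum (fun v' =>
    w (cellv i) v' * f (translate v' l)) + Q v * f v.
    by rewrite /schr_op /adj_op -{1}(translate_coord v) rsum_weight_translate.
  have sfl : asum (fun v' => w (cellv i) v' * f (translate v' l)).
    by apply: (@weight_mul_asum _ _ C) => v'; rewrite ger0_norm // ltW.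
  have : q ^+ L v * rsum (fun v' => w (cellv i) v' * f v') <=
         rsum (fun v' => w (cellv i) v' * f (translate v' l)).
    rewrite -rsumZ //; apply: le_rsum => // [|v']; first exact: asumZ.
    rewrite mulrCA ler_wpM2l ?weight_ge0 // /f /U coord_translate /= mulrCA.
    rewrite ler_wpM2l ?(ltW (u_gt0 _)) // -exprD ler_wiXn2l ?(ltW q0) ?(ltW q1)
      //.
    by rewrite /L coord_translate /= addnC lat_normD.
  have : q ^+ L v * ((E - Q (cellv i) - e) * u i) <=
         q ^+ L v * rsum (fun v' => w (cellv i) v' * f v').
    by rewrite ler_wpM2l // exprn_ge0 // ltW.
  move=> A B; rewrite -lerBlDr (potential_cell v) -/i; apply: le_trans B.
  apply: le_trans A; rewrite /f -/(U v).
  by move: (q ^+ L v) (U v) (Q _) => x y t; rewrite le_eqVlt; apply/orP;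
    left; apply/eqP; ring.
have [W W0 rW] := weight_row_bound.
have sHf : sqsum (schr_op w Q f).
  apply: (schr_sqsum (W := W) (Qm := \sum_i `|Q (cellv i)|)) => //.
  - exact: weight_ge0.
  - exact: weight_sym.
  - exact: weight_asum.
  - exact: potential_bound.
exists f; split=> //.
  pose v0 := cellv (Ordinal nu_gt0).
  by apply: lt_le_trans (sqr_le_ip v0 sf); rewrite exprn_gt0.
rewrite /ip -rsumZ; last exact: asum_mul.
apply: le_rsum; [by apply: asumZ; exact: asum_mul|exact: asum_mul|].
by move=> v; rewrite mulrCA ler_wpM2l // ltW.
Qed.

Lemma ground_state_max_spectrum : is_max_spectrum (@schroedinger R d nu G) E.
Proof.
have [W W0 rW] := weight_row_bound.
have w0 := @weight_ge0 _ _ _ G; have ws := @weight_sym _ _ _ G.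
split.
  exact: (schr_spectrum_top w0 ws weight_asum W0 rW potential_bound U_gt0
    wU_asum uE
    ground_state_approx).
move=> z zS; apply: contrapT => H; apply: zS.
apply: (schr_resolvent w0 ws weight_asum W0 rW potential_bound U_gt0 wU_asum
  uE).
move=> x zx; rewrite ltNge; apply/negP => xE.
by apply: H; exists x.
Qed.

End GroundState.
End PeriodicGraph.

(** [eigenvalue] refers to row vectors, whereas Bloch functions come from column eigenvectors of the
    Floquet matrix; transposition passes from one to the other. *)
Lemma char_poly_tr (F : comNzRingType) n (A : 'M[F]_n) :
  char_poly A^T = char_poly A.
Proof.
rewrite /char_poly -[RHS]det_tr; congr (\det _).
by apply/matrixP => i j; rewrite !mxE eq_sym.
Qed.

(** * Floquet spectrum and Bloch functions *)

Section Floquet.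
Context (R : realType) (d nu : nat) (G : periodic_graph R d nu).

Local Notation V := (vertex (vertices G)).
Local Notation cellv := (cell_vertex (vertices G)).
Local Notation w := (@weight R d nu G).
Local Notation Q := (@potential R d nu G).

Lemma floquet_spectrumP theta (x : R) : reflect
  (exists2 z, root (char_poly (floquet_matrix G theta)) z & complex.Re z = x)
  (x \in floquet_spectrum G theta).
Proof.
rewrite /floquet_spectrum mem_sort.
case: closed_field_poly_normal => r /= pE.
have rootE z : root (char_poly (floquet_matrix G theta)) z = (z \in r).
  by rewrite pE (monicP (char_poly_monic _)) scale1r root_prod_XsubC.
apply: (iffP mapP) => [[z zr ->]|[z rz <-]].
  by exists z => //; rewrite rootE.
by exists z => //; rewrite -rootE.
Qed.

Lemma size_floquet_spectrum theta : size (floquet_spectrum G theta) = nu.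
Proof.
rewrite /floquet_spectrum size_sort size_map.
case: closed_field_poly_normal => r /= pE; apply: succn_inj.
rewrite -(size_char_poly (floquet_matrix G theta)) pE.
by rewrite (monicP (char_poly_monic _)) scale1r size_prod_XsubC.
Qed.

Lemma floquet_eigenvalue_mem (j : nat) theta : (j < nu)%N ->
  floquet_eigenvalue G j theta \in floquet_spectrum G theta.
Proof. by move=> jn; rewrite mem_nth // size_floquet_spectrum. Qed.

Lemma floquet_eigenvalue_max theta x : x \in floquet_spectrum G theta ->
  x <= floquet_eigenvalue G nu.-1 theta.
Proof.
move=> xs; have sx := size_floquet_spectrum theta.
have ix : (index x (floquet_spectrum G theta) < nu)%N
  by rewrite -{2}sx index_mem.
rewrite -{1}(nth_index 0 xs) /floquet_eigenvalue.
have nu0 : (0 < nu)%N by apply: leq_ltn_trans ix.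
apply: (sorted_leq_nth le_trans le_refl) => //.
- by rewrite /floquet_spectrum sort_sorted //; exact: le_total.
- by rewrite inE sx.
- by rewrite inE sx ltn_predL.
- by rewrite -ltnS prednK.
Qed.

Definition bloch_lift (theta : 'rV[R]_d) (psi : 'I_nu -> R[i]) (v : V) : R[i] :=
  psi (coord v).1 * cis (2 * pi * dot_int theta (coord v).2).

Lemma dot_intD (theta : 'rV[R]_d) k l :
  dot_int theta (k + l) = dot_int theta k + dot_int theta l.
Proof.
rewrite /dot_int -big_split; apply: eq_bigr => i _ /=.
by rewrite mxE intrD mulrDr.
Qed.

Lemma bloch_lift_translate theta psi v l : bloch_lift theta psi
  (translate v l) =
  cis (2 * pi * dot_int theta l) * bloch_lift theta psi v.
Proof.
by rewrite /bloch_lift coord_translate /= dot_intD mulrDr cisD; ring.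
Qed.

Lemma bloch_lift_cell theta psi i : bloch_lift theta psi (cellv i) = psi i.
Proof.
rewrite /bloch_lift coord_cell /= /dot_int big1 => [|j _].
  by rewrite mulr0 /cis cos0 sin0 mulr1.
by rewrite mxE mulr0.
Qed.

Lemma bloch_lift_sqr theta psi v :
  complex.Re (bloch_lift theta psi v) ^+ 2 + complex.Im
    (bloch_lift theta psi v) ^+ 2 =
  complex.Re (psi (coord v).1) ^+ 2 + complex.Im (psi (coord v).1) ^+ 2.
Proof.
rewrite /bloch_lift; set x := 2 * pi * _.
case: (psi _) => a b /=; rewrite -[RHS]mulr1 -(cos2Dsin2 x); ring.
Qed.

Lemma floquet_lift theta psi z :
    (forall i, \sum_j floquet_matrix G theta i j * psi j = z * psi i) ->
  forall v, schroedinger (bloch_lift theta psi) v = z * bloch_lift theta psi v.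
Proof.
move=> psiE v; pose Psi := bloch_lift theta psi; rewrite -/Psi.
(* The extra 1 lets the bound [C - 1] on squared moduli give the bound [C] on real and imaginary
   parts, through [2 |x| <= 1 + x^2]. *)
pose C := \sum_j (complex.Re (psi j) ^+ 2 + complex.Im (psi j) ^+ 2) + 1.
have C1 v' : complex.Re (Psi v') ^+ 2 + complex.Im (Psi v') ^+ 2 <= C - 1.
  rewrite bloch_lift_sqr /C addrK (bigD1 (coord v').1) //= lerDl sumr_ge0 //.
  by move=> j _; rewrite addr_ge0 // sqr_ge0.
have sqr_bound (x y : R) : x ^+ 2 + y ^+ 2 <= C - 1 -> `|x| <= C.
  move=> xy; have := sqr_ge0 y; have := sqr_ge0 (`|x| - 1).
  by rewrite -(real_normK (num_real x)) in xy *; nra.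
have sw v0 : asum (fun v' => complex.Re ((w v0 v')%:C * Psi v')) /\
             asum (fun v' => complex.Im ((w v0 v')%:C * Psi v')).
  have -> : (fun v' => complex.Re ((w v0 v')%:C * Psi v')) = fun v' =>
    w v0 v' * complex.Re (Psi v').
    by apply/funext => v'; case: (Psi v') => a b /=; ring.
  have -> : (fun v' => complex.Im ((w v0 v')%:C * Psi v')) = fun v' =>
    w v0 v' * complex.Im (Psi v').
    by apply/funext => v'; case: (Psi v') => a b /=; ring.
  split; apply: (@weight_mul_asum _ _ _ G _ _ C) => v';
    first exact: sqr_bound (C1 v').
  by apply: (sqr_bound _ (complex.Re (Psi v'))); rewrite addrC.
(* A translation by [l] only multiplies the lift by a phase, so the equation has to be checked in
   the cell, where the sum over the lattice rebuilds the matrix entries. *)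
rewrite /schroedinger /adjacency -{1}(translate_coord v) csum_weight_translate.
rewrite -{5}(translate_coord v) potential_cell -[in Psi v](translate_coord v).
move: (coord v).1 (coord v).2 => i l.
under [X in csum X]funext do rewrite /Psi bloch_lift_translate mulrCA.
have [sr si] := sw (cellv i); rewrite csumZ // /Psi !bloch_lift_translate
  bloch_lift_cell.
suff -> : csum (fun v' => (w (cellv i) v')%:C * bloch_lift theta psi v') =
    z * psi i - (Q (cellv i))%:C * psi i by ring.
have be := cell_translate_bij (vertices G).
rewrite (csum_reindex _ be) csum_pair_fin; last 2 first.
- exact: (asum_reindex _ be).1 sr.
- exact: (asum_reindex _ be).1 si.
have -> : (Q (cellv i))%:C * psi i = \sum_j ((cell_potential G i)%:C *+
  (i == j)) * psi j.
  rewrite (bigD1 i) //= eqxx mulr1n big1 ?addr0 // => j.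
  by rewrite eq_sym => /negbTE ->; rewrite mulr0n mul0r.
rewrite -psiE -sumrB; apply: eq_bigr => j _; rewrite mxE mulrDl addrK.
rewrite [RHS]mulrC -csumZ.
- congr csum; apply/funext => k /=.
  by rewrite /bloch_lift cell_translateK /= mulrCA.
- have := cell_weight_asum G i j; apply: asum_le => k.
  rewrite [X in `|X|](_ : _ = cell_weight G i j k * cos
    (2 * pi * dot_int theta k)).
    by rewrite normrM ler_piMr // cos_max.
  by rewrite /=; ring.
have := cell_weight_asum G i j; apply: asum_le => k.
rewrite [X in `|X|](_ : _ = cell_weight G i j k * sin
  (2 * pi * dot_int theta k)).
  by rewrite normrM ler_piMr // sin_max.
by rewrite /=; ring.
Qed.

Lemma floquet_matrix0 i j : floquet_matrix G 0 i j = (floquet0 G i j)%:C.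
Proof.
rewrite mxE /floquet0 /csum.
have dot0 k : dot_int 0 k = 0 :> R by rewrite /dot_int big1 // => l _;
  rewrite mxE mul0r.
under eq_rsum do rewrite dot0 mulr0 /cis cos0 sin0 /= mulr1 mul0r subr0.
under [X in _ +i* X]eq_rsum do rewrite dot0 mulr0 /cis cos0 sin0 /= mulr0 mul0r
  addr0.
rewrite rsum0; apply/eqP; rewrite eq_complex /=.
by case: (i == j); rewrite ?mulr1n ?mulr0n /= ?addr0 !eqxx.
Qed.

Lemma floquet_spectrum0 (E : R) (u : 'I_nu -> R) i0 : u i0 != 0 ->
    (forall i, \sum_j floquet0 G i j * u j = E * u i) ->
  E \in floquet_spectrum G 0.
Proof.
move=> ui0 uE; apply/floquet_spectrumP; exists E%:C => //.
rewrite -eigenvalue_root_char; apply/eigenvalueP.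
exists (\row_i (u i)%:C).
  apply/rowP => i; rewrite !mxE -rmorphM -uE rmorph_sum; apply: eq_bigr => j _.
  by rewrite mxE floquet_matrix0 floquet0_sym mulrC rmorphM.
apply/eqP => /rowP /(_ i0); rewrite !mxE => /eqP.
by rewrite eq_complex /= eqxx andbT (negbTE ui0).
Qed.

End Floquet.

(** For [d = 0] the torus is a point, so the top band is constant; for [nu = 0] there is no vertex
    and the spectrum is empty. [is_max_spectrum] determines [m], so the existential speaks of the
    maximum of the spectrum. *)
Theorem theorem4p9 (R : realType) (d nu : nat) (d_gt0 : (0 < d)%N)
    (nu_gt0 : (0 < nu)%N) (G : periodic_graph R d nu)
    (G_connected : graph_connected G) :
  ~ (exists c : R, forall theta : 'rV[R]_d,
       floquet_eigenvalue G nu.-1 theta = c) /\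
  (exists m : R, is_max_spectrum (@schroedinger R d nu G) m /\
                 ~ is_eigenvalue (@schroedinger R d nu G) m%:C).
Proof.
have [E [u [u0 uE UE]]] := periodic_ground_state nu_gt0 G_connected.
split; last first.
  exists E; split.
    exact: (ground_state_max_spectrum nu_gt0 u0 UE).
  exact: (ground_state_not_eigenvalue d_gt0 nu_gt0 G_connected u0 UE).
case=> c cE; pose i0 := Ordinal nu_gt0; pose j0 := Ordinal d_gt0.
(* [E] is an eigenvalue of [H(0)], hence at most the top one. *)
have Ec : E <= c.
  by rewrite -(cE 0) floquet_eigenvalue_max // (floquet_spectrum0
    (i0 := i0) _ uE) // gt_eqF.
(* Half a period of the torus in one direction: the Bloch phase of the corresponding lattice period
   is [cis pi = -1]. *)
pose theta : 'rV[R]_d := 2^-1 *: delta_mx 0 j0.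
have /floquet_spectrumP[z zroot zc] : c \in floquet_spectrum G theta.
  by rewrite -(cE theta) floquet_eigenvalue_mem // ltn_predL.
move: zroot; rewrite -char_poly_tr -eigenvalue_root_char =>
  /eigenvalueP[psi0 psi0E psi0_neq0].
pose psi i := psi0 0 i.
have psiE i : \sum_j floquet_matrix G theta i j * psi j = z * psi i.
  move/rowP/(_ i) : psi0E; rewrite !mxE => <-; apply: eq_bigr => j _.
  by rewrite mulrC [in RHS]mxE.
pose h i := complex.Re (psi i) ^+ 2 + complex.Im (psi i) ^+ 2.
have h0 i : 0 <= h i by rewrite addr_ge0 // sqr_ge0.
(* The modulus of a Bloch function and [U] are both periodic, so a maximum over the cell is a
   maximum of [|f| / U] over the whole graph. *)
have [i imax] := cell_arg_max nu_gt0 (fun i => h i / u i ^+ 2).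
have u20 j : 0 < u j ^+ 2 by rewrite exprn_gt0.
have hi : 0 < h i / u i ^+ 2.
  rewrite lt_neqAle divr_ge0 ?(ltW (u20 _)) // andbT eq_sym;
    apply: contra psi0_neq0 => /eqP hi0.
  apply/eqP/rowP => j; rewrite [RHS]mxE -/(psi j).
  have : h j <= 0 by have := imax j; rewrite hi0 pmulr_lle0 // invr_gt0.
  rewrite le_eqVlt ltNge h0 orbF /h paddr_eq0 ?sqr_ge0 // !sqrf_eq0.
  by case: (psi j) => a b /= /andP[/eqP-> /eqP->].
pose M := Num.sqrt (h i / u i ^+ 2); have M0 : 0 < M by rewrite sqrtr_gt0.
have ME v : (M * v) ^+ 2 = h i / u i ^+ 2 * v ^+ 2
  by rewrite exprMn sqr_sqrtr // ltW.
have Ez : E <= complex.Re z by rewrite zc.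
pose v0 := cell_vertex (vertices G) i.
have := ground_state_rigid G_connected u0 UE (f := bloch_lift theta psi)
  (v0 := v0) Ez M0.
move=> /(_ _ _ (floquet_lift psiE)) rigid.
have {rigid} : bloch_lift theta psi (translate v0 (delta_mx 0 j0)) * (u i)%:C =
    psi i * (u i)%:C.
  have := rigid _ _ (translate v0 (delta_mx 0 j0)).
  rewrite bloch_lift_cell coord_translate coord_cell /=; apply=> [v|].
    rewrite bloch_lift_sqr -/(h _) ME -[leLHS](divfK (_ : u
      (coord v).1 ^+ 2 != 0)).
      by rewrite ler_wpM2r ?imax // ltW.
    by rewrite gt_eqF.
  by rewrite ME -/(h i) divfK // gt_eqF.
have ui : (u i)%:C != 0 :> R[i] by rewrite eq_complex /= gt_eqF.
(* Rigidity makes the Bloch function invariant under the period that multiplies it by -1, so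
   [psi i = 0], against [0 < h i]. *)
move/(mulIf ui); rewrite bloch_lift_translate bloch_lift_cell.
have -> : 2 * pi * dot_int theta (delta_mx 0 j0) = pi :> R.
  rewrite /dot_int (bigD1 j0) //= big1 ?addr0 => [|l lj].
    by rewrite !mxE !eqxx /= mulr1; field.
  by rewrite [X in X * _](_ : _ = 0) ?mul0r // !mxE (negbTE lj) andbF mulr0.
rewrite /cis cospi sinpi => /eqP; rewrite eq_complex.
have: 0 < h i by move: hi; rewrite pmulr_lgt0 // invr_gt0.
rewrite /h; case: (psi i) => a b /= hab /andP[/eqP A /eqP B].
have a0 : a = 0 by lra.
have b0 : b = 0 by lra.
by move: hab; rewrite a0 b0 expr0n addr0 ltxx.
Qed.
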